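(* Any relation definable by an $\mathsf{EP\text{-}FC[REG]}$ formula can be maintained in $\mathsf{DynCQ}$.
   Context: $\mathsf{EP\text{-}FC[REG]}$: over a finite alphabet $\Sigma$ and variables $\Xi$ with universe variable $\mathfrak u$, formulas are built from word equations $(x\doteq\alpha)$ ($x\in\Xi$, $\alpha\in(\Sigma\cup\Xi)^*$) and regular constraints $(x\,\dot\in\,\gamma)$ using $\wedge$, $\vee$ and $\exists$ (not over $\mathfrak u$); semantics as in first-order logic for substitutions $\sigma$ (morphisms fixing letters) that map every variable to a factor of $\sigma(\mathfrak u)$, quantifiers ranging over factors of $\sigma(\mathfrak u)$, with $\sigma\models(x\doteq\alpha)$ iff $\sigma(x)=\sigma(\alpha)$ and $\sigma\models(x\,\dot\in\,\gamma)$ iff $\sigma(x)\in L(\gamma)$. A formula with free variables $x_1,\dots,x_k$ defines, on input $w=\sigma(\mathfrak u)$, the relation $R\subseteq(\Sigma^* )^k$ of tuples $(\sigma(x_1),\dots,\sigma(x_k))$ of satisfying substitutions. Dynamic setting: word-structure with domain $D=\{1,\dots,n+1\}$, order $<$, constant $\$=n+1$, unary $P_a$ ($a\in\Sigma$), each position $\le n$ in at most one $P_a$, $\$$ in none; $w[i]$ is the letter at $i$ or $\varepsilon$; $w[i,j]=w[i]\cdots w[j]$. Updates $\mathrm{ins}_a(i)$ (set $w[i]=a$, if $w[i]\neq a$, $i\ne\$$) and $\mathrm{reset}(i)$ (set $w[i]=\varepsilon$, if $w[i]\ne\varepsilon$). A dynamic program has auxiliary relations over $D$ initialized by first-order formulas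 on the initially empty structure, and for each auxiliary relation and update type an update formula $\phi(u;\bar x)$ defining the new relation in terms of the updated word structure and old auxiliary relations; it maintains a relation if a designated auxiliary relation always equals it. $\mathsf{DynCQ}$: update formulas are conjunctive queries (atoms, $\wedge$, $\exists$). A relation $R\subseteq(\Sigma^* )^k$ is maintained in $\mathsf{DynCQ}$ if the $2k$-ary relation $\bar R$ of all $(x_1,y_1,\dots,x_k,y_k)\in D^{2k}$ with $(w[x_1,y_1],\dots,w[x_k,y_k])\in R$ and $w[z]\ne\varepsilon$ for all $z\in\{x_1,y_1,\dots,x_k,y_k\}$ can be maintained in $\mathsf{DynCQ}$. *)

(* Defs.v *)
From mathcomp Require Import all_boot.

Set Implicit Arguments.
Unset Strict Implicit.
Unset Printing Implicit Defensive.

(** * EP-FC[REG] *)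

Inductive regex (Sigma : Type) : Type :=
| RVoid
| REps
| RChar of Sigma
| RAlt of regex Sigma & regex Sigma
| RCat of regex Sigma & regex Sigma
| RStar of regex Sigma.

Arguments RVoid {Sigma}.
Arguments REps {Sigma}.

Fixpoint lang (Sigma : eqType) (g : regex Sigma) : seq Sigma -> Prop :=
  match g with
  | RVoid => fun=> False
  | REps => fun w => w = [::]
  | RChar a => fun w => w = [:: a]
  | RAlt g1 g2 => fun w => lang g1 w \/ lang g2 w
  | RCat g1 g2 => fun w =>
      exists w1 w2, [/\ w = w1 ++ w2, lang g1 w1 & lang g2 w2]
  | RStar g1 => fun w =>
      exists2 ws, w = flatten ws & forall v, v \in ws -> lang g1 v
  end.

(** The universe variable is [None]; the other variables are [Some x].
    Quantifiers bind an [x : nat], hence never the universe variable. *)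
Definition var := option nat.
Definition uvar : var := None.

Inductive epfc (Sigma : Type) : Type :=
| EEq of var & seq (Sigma + var)
| EReg of var & regex Sigma
| EAnd of epfc Sigma & epfc Sigma
| EOr of epfc Sigma & epfc Sigma
| EEx of nat & epfc Sigma.

Fixpoint free_vars (Sigma : Type) (phi : epfc Sigma) : seq var :=
  match phi with
  | EEq x alpha =>
      x :: pmap (fun s => if s is inr y then Some y else None) alpha
  | EReg x _ => [:: x]
  | EAnd p q | EOr p q => free_vars p ++ free_vars q
  | EEx x p => [seq y <- free_vars p | y != Some x]
  end.

Definition subst (Sigma : Type) (sigma : var -> seq Sigma)
    (alpha : seq (Sigma + var)) : seq Sigma :=
  flatten [seq match s with inl a => [:: a] | inr x => sigma x end | s <- alpha].

Definition update_subst (Sigma : Type) (sigma : var -> seq Sigma)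
    (x : nat) (v : seq Sigma) : var -> seq Sigma :=
  fun y => if y == Some x then v else sigma y.

(** [infix v w]: [v] is a factor of [w]. *)
Fixpoint models (Sigma : eqType) (sigma : var -> seq Sigma)
    (phi : epfc Sigma) : Prop :=
  match phi with
  | EEq x alpha => sigma x = subst sigma alpha
  | EReg x g => lang g (sigma x)
  | EAnd p q => models sigma p /\ models sigma q
  | EOr p q => models sigma p \/ models sigma q
  | EEx x p =>
      exists2 v, infix v (sigma uvar) & models (update_subst sigma x v) p
  end.

(** A relation over words that may depend on the input word. *)
Definition word_rel (Sigma : Type) (k : nat) :=
  seq Sigma -> k.-tuple (seq Sigma) -> Prop.

Definition defined_rel (Sigma : eqType) (phi : epfc Sigma) (k : nat)
    (xs : k.-tuple nat) : word_rel Sigma k :=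
  fun w t => exists sigma : var -> seq Sigma,
    [/\ sigma uvar = w,
        forall x, infix (sigma x) w,
        models sigma phi
      & t = [tuple of [seq sigma (Some x) | x <- xs]]].

(** [xs] lists, without repetition and in some order, the free variables of
    [phi] other than the universe variable. *)
Definition epfc_definable (Sigma : eqType) (k : nat) (R : word_rel Sigma k) :
    Prop :=
  exists (phi : epfc Sigma) (xs : k.-tuple nat),
    [/\ uniq xs,
        forall x, (x \in xs) = (Some x \in free_vars phi)
      & forall w t, R w t <-> defined_rel phi xs w t].

(** * First-order formulas over word structures with auxiliary relations *)

Record schema : Type := Schema { rel_name :> finType; arity : rel_name -> nat }.
Arguments arity {s} _.

Definition no_rel : schema := @Schema void (fun=> 0).

(** Formulas are well-scoped: the free variables of a formula of type
    [fo Sigma S m] are the [m] elements of ['I_m]. A quantifier binds variable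
    0 of its body and shifts the others by one. *)
Inductive term (m : nat) : Type :=
| TVar of 'I_m
| TEnd.
Arguments TEnd {m}.

Inductive atom (Sigma : Type) (S : schema) (m : nat) : Type :=
| ALt of term m & term m
| AEq of term m & term m
| ALetter of Sigma & term m
| ARel (r : S) of (arity r).-tuple (term m).

Inductive fo (Sigma : Type) (S : schema) (m : nat) : Type :=
| FAtom of atom Sigma S m
| FNot of fo Sigma S m
| FAnd of fo Sigma S m & fo Sigma S m
| FOr of fo Sigma S m & fo Sigma S m
| FEx of fo Sigma S m.+1
| FAll of fo Sigma S m.+1.

Fixpoint is_cq (Sigma : Type) (S : schema) (m : nat) (f : fo Sigma S m) : bool :=
  match f with
  | FAtom _ => true
  | FAnd f1 f2 => is_cq f1 && is_cq f2
  | FEx f1 => is_cq f1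
  | _ => false
  end.

(** The domain {1, ..., n+1} is represented, shifted by one, by ['I_n.+1]; the
    constant $ is [ord_max]. [w i = Some a] means P_a(i), and [w i = None] means
    that no P_a holds at i. That $ carries no letter is an invariant of the
    structures reachable from the empty one by legal updates. *)
Definition word_struct (Sigma : finType) (n : nat) :=
  {ffun 'I_n.+1 -> option Sigma}.

Definition aux_db (S : schema) (n : nat) :=
  forall r : S, {set (arity r).-tuple 'I_n.+1}.

Definition no_db (n : nat) : aux_db no_rel n := fun r => match r with end.

Definition eval_term (n m : nat) (e : m.-tuple 'I_n.+1) (t : term m) : 'I_n.+1 :=
  match t with TVar i => tnth e i | TEnd => ord_max end.

Definition eval_atom (Sigma : finType) (S : schema) (n m : nat)
    (w : word_struct Sigma n) (A : aux_db S n) (e : m.-tuple 'I_n.+1)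
    (a : atom Sigma S m) : bool :=
  match a with
  | ALt s t => eval_term e s < eval_term e t
  | AEq s t => eval_term e s == eval_term e t
  | ALetter a t => w (eval_term e t) == Some a
  | ARel r ts => [tuple of map (eval_term e) ts] \in A r
  end.

Fixpoint eval (Sigma : finType) (S : schema) (n m : nat)
    (w : word_struct Sigma n) (A : aux_db S n) (e : m.-tuple 'I_n.+1)
    (f : fo Sigma S m) : bool :=
  match f with
  | FAtom a => eval_atom w A e a
  | FNot f1 => ~~ eval w A e f1
  | FAnd f1 f2 => eval w A e f1 && eval w A e f2
  | FOr f1 f2 => eval w A e f1 || eval w A e f2
  | FEx f1 => [exists d, eval w A [tuple of d :: e] f1]
  | FAll f1 => [forall d, eval w A [tuple of d :: e] f1]
  end.

(** * Dynamic programs *)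

Inductive update_type (Sigma : Type) : Type :=
| Ins of Sigma
| Reset.
Arguments Reset {Sigma}.

Definition empty_struct (Sigma : finType) (n : nat) : word_struct Sigma n :=
  [ffun=> None].

Definition legal (Sigma : finType) (n : nat) (w : word_struct Sigma n)
    (o : update_type Sigma) (i : 'I_n.+1) : bool :=
  match o with
  | Ins a => (w i != Some a) && (i != ord_max)
  | Reset => w i != None
  end.

Definition apply_update (Sigma : finType) (n : nat) (w : word_struct Sigma n)
    (o : update_type Sigma) (i : 'I_n.+1) : word_struct Sigma n :=
  [ffun j => if j == i then (if o is Ins a then Some a else None) else w j].

(** In the update formula of an auxiliary relation of arity [m], variable 0 is
    the updated position and variables 1, ..., m are the arguments. *)
Record dyn_program (Sigma : finType) : Type := DynProgram {
  dp_schema : schema;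
  dp_init : forall r : dp_schema, fo Sigma no_rel (arity r);
  dp_update : update_type Sigma ->
    forall r : dp_schema, fo Sigma dp_schema (arity r).+1
}.

Definition init_db (Sigma : finType) (P : dyn_program Sigma) (n : nat) :
    aux_db (dp_schema P) n :=
  fun r => [set t | eval (empty_struct Sigma n) (@no_db n) t (dp_init r)].
Arguments init_db {Sigma} P n r.

(** Update formulas see the updated word and the old auxiliary relations. *)
Definition step_db (Sigma : finType) (P : dyn_program Sigma) (n : nat)
    (w' : word_struct Sigma n) (A : aux_db (dp_schema P) n)
    (o : update_type Sigma) (i : 'I_n.+1) : aux_db (dp_schema P) n :=
  fun r => [set t | eval w' A [tuple of i :: (t : (arity r).-tuple _)]
                         (dp_update o r)].

Inductive reachable (Sigma : finType) (P : dyn_program Sigma) (n : nat) :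
    word_struct Sigma n -> aux_db (dp_schema P) n -> Prop :=
| reachable_init : reachable (empty_struct Sigma n) (init_db P n)
| reachable_step w A o i :
    reachable w A -> legal w o i ->
    reachable (apply_update w o i) (step_db (apply_update w o i) A o i).

Definition struct_rel (Sigma : finType) (m : nat) :=
  forall n, word_struct Sigma n -> m.-tuple 'I_n.+1 -> Prop.

(** One program has to work for all domain sizes. *)
Definition maintains (Sigma : finType) (P : dyn_program Sigma) (m : nat)
    (Q : struct_rel Sigma m) : Prop :=
  exists (r : dp_schema P) (e : m = arity r),
    forall n (w : word_struct Sigma n) (A : aux_db (dp_schema P) n),
      reachable w A ->
      forall t : m.-tuple 'I_n.+1, tcast e t \in A r <-> Q n w t.

Definition cq_program (Sigma : finType) (P : dyn_program Sigma) : Prop :=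
  forall o (r : dp_schema P), is_cq (dp_update o r).

Definition in_DynCQ (Sigma : finType) (m : nat) (Q : struct_rel Sigma m) : Prop :=
  exists2 P : dyn_program Sigma, cq_program P & maintains P Q.

(** * Maintaining relations over words *)

Definition word_of (Sigma : finType) (n : nat) (w : word_struct Sigma n) :
    seq Sigma :=
  pmap w (enum 'I_n.+1).

(** w[i,j], the empty word if j < i. *)
Definition word_between (Sigma : finType) (n : nat) (w : word_struct Sigma n)
    (i j : 'I_n.+1) : seq Sigma :=
  pmap w [seq z : 'I_n.+1 <- enum 'I_n.+1 | i <= z <= j].

(** The tuple [t] is (x_1, y_1, ..., x_k, y_k): with 0-based indices, the i-th
    pair sits at indices 2i and 2i+1. *)
Definition bar (Sigma : finType) (k : nat) (R : word_rel Sigma k) :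
    struct_rel Sigma (2 * k) :=
  fun n w t =>
    (forall z, z \in t -> w z != None) /\
    R (word_of w)
      [tuple word_between w (nth ord_max t (2 * i)) (nth ord_max t (2 * i).+1)
         | i < k].

Definition maintained_in_DynCQ (Sigma : finType) (k : nat)
    (R : word_rel Sigma k) : Prop :=
  in_DynCQ (bar R).

(* Main.v *)
(** Factors of the input are represented by half-open intervals [x, y) of
    positions, so that a factor not containing the updated position i keeps its
    value and w'[x, y) = w[x, i) w'[i] w[i+1, y) otherwise.  Two families of
    relations are stored: w[x, y) matches g*, for the starred subexpressions g*,
    and w[x, y) = w[x', y').  After an update at i, a match of g* is witnessed by
    a piece [z, z') around i such that w'[z, z') matches g and w[x, z), w[z', y)
    match g*; concatenation and union need no storage, as they are
    positive existential.  Equality of factors is updated by cutting both of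
    them at i and at the images of i under the match.  All remaining connectives
    of EP-FC[REG] are positive existential in these relations.

    Disjunction is simulated by conjunctive queries: every stored relation Q gets
    an additional argument z and is replaced by (z <> $ \/ Q), and P \/ Q becomes
    exists z1 z2, Or(z, z1, z2) /\ P(z1) /\ Q(z2) with a static relation Or.  This
    needs a second element besides $, which exists as soon as an update is
    legal. *)

Require Import Defs.
From mathcomp Require Import all_boot.
From Stdlib Require Import FunctionalExtensionality ClassicalEpsilon.

Set Implicit Arguments.
Unset Strict Implicit.
Unset Printing Implicit Defensive.

(** * Terms and environments under a quantifier *)

Definition shift_term m (t : term m) : term m.+1 :=
  if t is TVar i then TVar (lift ord0 i) else TEnd.

Definition scons T (x : T) (e : nat -> T) (j : nat) : T :=
  if j is j'.+1 then e j' else x.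

Lemma eval_shift_term n m (e : m.-tuple 'I_n.+1) d (t : term m) :
  eval_term [tuple of d :: e] (shift_term t) = eval_term e t.
Proof. by case: t => [i|] //=; rewrite tnthS. Qed.

Lemma eval_shift_env n m (e : m.-tuple 'I_n.+1) d (rho : nat -> term m) :
  (fun j => eval_term [tuple of d :: e] (shift_term (rho j))) =
  (fun j => eval_term e (rho j)).
Proof. by apply: functional_extensionality => j; rewrite eval_shift_term. Qed.

(** * Definability of queries *)

Section Definability.

Variable Sigma : finType.

(** Environments are total functions on [nat], so a query carries no arity in its type and renaming
    of variables is composition. *)
Definition query := forall n, word_struct Sigma n -> (nat -> 'I_n.+1) -> Prop.

Record desc : Type := Desc { desc_arity : nat; desc_sem : query }.

(** Quantifying over all term assignments [rho] lets constructions pass below a quantifier, where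
    the terms are shifted. *)
Definition fo_definable (Q : forall n, (nat -> 'I_n.+1) -> Prop) : Prop :=
  forall m (rho : nat -> term m), exists f : fo Sigma no_rel m,
    forall n (e : m.-tuple 'I_n.+1),
      eval (empty_struct Sigma n) (@no_db n) e f <->
      Q n (fun j => eval_term e (rho j)).

(** [P] does not depend on the structure, so it can be decided classically before the formula is
    chosen. *)
Lemma fo_const (P : Prop) : fo_definable (fun _ _ => P).
Proof.
move=> m rho; case: (excluded_middle_informative P) => HP.
  by exists (FAtom (AEq _ _ TEnd TEnd)) => n e /=; rewrite eqxx.
by exists (FNot (FAtom (AEq _ _ TEnd TEnd))) => n e /=; rewrite eqxx.
Qed.

Lemma fo_lt a b : fo_definable (fun n e => e a < e b).
Proof. by move=> m rho; exists (FAtom (ALt _ _ (rho a) (rho b))). Qed.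

Lemma fo_end a : fo_definable (fun n e => e a = ord_max).
Proof.
move=> m rho; exists (FAtom (AEq _ _ (rho a) TEnd)) => n e /=.
by split => /eqP.
Qed.

Lemma fo_not Q : fo_definable Q -> fo_definable (fun n e => ~ Q n e).
Proof.
move=> H m rho; have [f Hf] := H m rho; exists (FNot f) => n e /=.
by split => [/negP|] NQ; [move/Hf | apply/negP => /Hf].
Qed.

Lemma fo_and Q1 Q2 : fo_definable Q1 -> fo_definable Q2 ->
  fo_definable (fun n e => Q1 n e /\ Q2 n e).
Proof.
move=> H1 H2 m rho; have [f1 Hf1] := H1 m rho; have [f2 Hf2] := H2 m rho.
exists (FAnd f1 f2) => n e /=; rewrite -Hf1 -Hf2.
by split => [/andP|[-> ->]].
Qed.

Lemma fo_or Q1 Q2 : fo_definable Q1 -> fo_definable Q2 ->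
  fo_definable (fun n e => Q1 n e \/ Q2 n e).
Proof.
move=> H1 H2 m rho; have [f1 Hf1] := H1 m rho; have [f2 Hf2] := H2 m rho.
exists (FOr f1 f2) => n e /=; rewrite -Hf1 -Hf2.
by split => [/orP|/orP].
Qed.

Lemma fo_ex (Q : forall n, (nat -> 'I_n.+1) -> 'I_n.+1 -> Prop) :
  fo_definable (fun n e => Q n (fun j => e j.+1) (e 0)) ->
  fo_definable (fun n e => exists d, Q n e d).
Proof.
move=> H m rho.
have [f Hf] := H m.+1 (scons (TVar ord0) (fun j => shift_term (rho j))).
exists (FEx f) => n e /=; split.
  by case/existsP => d /Hf; rewrite eval_shift_env /= => ?; exists d.
by case=> d Hd; apply/existsP; exists d; apply/Hf; rewrite eval_shift_env.
Qed.

Lemma fo_iff Q1 Q2 : (forall n e, Q1 n e <-> Q2 n e) ->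
  fo_definable Q1 -> fo_definable Q2.
Proof.
by move=> E H m rho; have [f Hf] := H m rho; exists f => n e; rewrite Hf E.
Qed.

Lemma fo_ren (f : nat -> nat) Q :
  fo_definable Q -> fo_definable (fun n e => Q n (fun j => e (f j))).
Proof. by move=> H m rho; apply: (H m (fun j => rho (f j))). Qed.

Variables (T : finType) (D : T -> desc) (m0 : nat).

(** [None] is the output relation. Its arity is prescribed from outside, so unlike the stored
    relations it has no guard argument. *)
Definition aux_schema : schema :=
  @Schema (option T) (fun r => if r is Some j then (desc_arity (D j)).+1 else m0).

Definition stores n (w : word_struct Sigma n) (A : aux_db aux_schema n) : Prop :=
  forall (j : T) (t : (arity (Some j : aux_schema)).-tuple 'I_n.+1),
    t \in A (Some j) <->
    nth ord_max t 0 != ord_max \/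
    desc_sem (D j) w (fun k => nth ord_max t k.+1).

(* The word before the update, the updated position and an environment. *)
Definition update_query :=
  forall n, word_struct Sigma n -> 'I_n.+1 -> (nat -> 'I_n.+1) -> Prop.

(* The update formula is insensitive to the current word [w1]: the letters are
   taken from the stored relations. *)
Definition cq_definable (Q : update_query) : Prop :=
  forall m (rho : nat -> term m) (iota z : term m),
  exists2 f : fo Sigma aux_schema m, is_cq f &
    forall n (w w1 : word_struct Sigma n) A (e : m.-tuple 'I_n.+1),
      0 < n -> w ord_max = None -> eval_term e iota != ord_max -> stores w A ->
      eval w1 A e f <->
      eval_term e z != ord_max \/
      Q n w (eval_term e iota) (fun j => eval_term e (rho j)).

Lemma cq_stored j m (ts : seq (term m)) (z : term m) :
  size ts = desc_arity (D j) ->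
  exists2 f : fo Sigma aux_schema m, is_cq f &
    forall n (w w1 : word_struct Sigma n) A (e : m.-tuple 'I_n.+1),
      stores w A ->
      eval w1 A e f <->
      eval_term e z != ord_max \/
      desc_sem (D j) w (nth ord_max [seq eval_term e t | t <- ts]).
Proof.
move=> sz.
have H : size (z :: ts) == arity (Some j : aux_schema) by rewrite /= sz.
exists (FAtom (ARel _ (Tuple H))) => // n w w1 A e stA /=.
by rewrite stA /=.
Qed.

Lemma cq_rel j (args : seq nat) : size args = desc_arity (D j) ->
  cq_definable
    (fun n w i e => desc_sem (D j) w (nth ord_max [seq e a | a <- args])).
Proof.
move=> sz m rho ii z.
have sz' : size [seq rho a | a <- args] = desc_arity (D j) by rewrite size_map.
have [f cf Hf] := cq_stored z sz'; exists f => // n w w1 A e _ _ _ /Hf ->.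
by rewrite -map_comp.
Qed.

Lemma cq_true : cq_definable (fun _ _ _ _ => True).
Proof.
move=> m rho ii z; exists (FAtom (AEq _ _ TEnd TEnd)) => // n w w1 A e _ _ _ _ /=.
by rewrite eqxx; split=> // _; right.
Qed.

Lemma cq_and Q1 Q2 : cq_definable Q1 -> cq_definable Q2 ->
  cq_definable (fun n w i e => Q1 n w i e /\ Q2 n w i e).
Proof.
move=> H1 H2 m rho ii z.
have [f1 c1 Hf1] := H1 m rho ii z; have [f2 c2 Hf2] := H2 m rho ii z.
exists (FAnd f1 f2); first by rewrite /= c1.
move=> n w w1 A e n0 wm im st /=.
have := Hf1 n w w1 A e n0 wm im st; have := Hf2 n w w1 A e n0 wm im st.
case: (eval w1 A e f1); case: (eval w1 A e f2) => /=; intuition.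
Qed.

Lemma cq_ex (Q : forall n, word_struct Sigma n -> 'I_n.+1 ->
                   (nat -> 'I_n.+1) -> 'I_n.+1 -> Prop) :
  cq_definable (fun n w i e => Q n w i (fun j => e j.+1) (e 0)) ->
  cq_definable (fun n w i e => exists d, Q n w i e d).
Proof.
move=> H m rho ii z.
have [f cf Hf] := H m.+1 (scons (TVar ord0) (fun j => shift_term (rho j)))
                    (shift_term ii) (shift_term z).
exists (FEx f) => // n w w1 A e n0 wm im st /=.
have E d : eval w1 A [tuple of d :: e] f <->
    eval_term e z != ord_max \/
    Q n w (eval_term e ii) (fun j => eval_term e (rho j)) d.
  by rewrite (Hf n w) // ?eval_shift_term // eval_shift_env.
split.
  by case/existsP => d /E [?|?]; [left | right; exists d].
case=> [zm|[d Hd]]; apply/existsP; first by exists ord0; apply/E; left.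
by exists d; apply/E; right.
Qed.

Lemma cq_iff (Q1 Q2 : update_query) :
  (forall n (w : word_struct Sigma n) i e, 0 < n -> w ord_max = None -> i != ord_max ->
     Q1 n w i e <-> Q2 n w i e) ->
  cq_definable Q1 -> cq_definable Q2.
Proof.
move=> E H m rho ii z; have [f cf Hf] := H m rho ii z.
by exists f => // n w w1 A e n0 wm im st; rewrite (Hf n w) // E.
Qed.

Lemma cq_ren (f : nat -> nat) Q :
  cq_definable Q -> cq_definable (fun n w i e => Q n w i (fun j => e (f j))).
Proof. by move=> H m rho; apply: (H m (fun j => rho (f j))). Qed.

Lemma cq_pos (Q : forall n, word_struct Sigma n -> 'I_n.+1 -> 'I_n.+1 ->
                   (nat -> 'I_n.+1) -> Prop) :
  cq_definable (fun n w i e => Q n w i (e 0) (fun j => e j.+1)) ->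
  cq_definable (fun n w i e => Q n w i i e).
Proof. by move=> H m rho ii z; apply: (H m (scons ii rho)). Qed.

(** A guard equal to [$] demands its query, any other value waives it. The relation says that if
    guard 0 demands, then so does guard 1 or guard 2. *)
Definition or_desc : desc :=
  Desc 3 (fun n w e => [|| e 0 != ord_max, e 1 == ord_max | e 2 == ord_max]).

Variables (j_or : T) (D_or : D j_or = or_desc).

Lemma cq_or_of_stored Q1 Q2 : cq_definable Q1 -> cq_definable Q2 ->
  cq_definable (fun n w i e => Q1 n w i e \/ Q2 n w i e).
Proof.
move=> H1 H2 m rho ii z.
pose sh t := shift_term (shift_term t) : term m.+2.
pose v0 : term m.+2 := TVar ord0; pose v1 : term m.+2 := TVar (lift ord0 ord0).
have [f1 c1 Hf1] := H1 m.+2 (fun j => sh (rho j)) (sh ii) v0.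
have [f2 c2 Hf2] := H2 m.+2 (fun j => sh (rho j)) (sh ii) v1.
have sz : size [:: sh z; v0; v1] = desc_arity (D j_or) by rewrite D_or.
(* The [Or] atom is itself guarded, by the constant [$], hence never waived. *)
have [f3 c3 Hf3] := cq_stored TEnd sz.
exists (FEx (FEx (FAnd f3 (FAnd f1 f2)))); first by rewrite /= c1 c2 c3.
move=> n w w1 A e n0 wm im st /=.
have Ee d1 d2 : (fun j => eval_term [tuple of d2 :: [tuple of d1 :: e]]
    (sh (rho j))) = (fun j => eval_term e (rho j)).
  by rewrite /sh (eval_shift_env _ _ (fun j => shift_term (rho j))) eval_shift_env.
have E1 d1 d2 : eval w1 A [tuple of d2 :: [tuple of d1 :: e]] f1 <->
    d2 != ord_max \/ Q1 n w (eval_term e ii) (fun j => eval_term e (rho j)).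
  by rewrite (Hf1 n w) // ?eval_shift_term // Ee.
have E2 d1 d2 : eval w1 A [tuple of d2 :: [tuple of d1 :: e]] f2 <->
    d1 != ord_max \/ Q2 n w (eval_term e ii) (fun j => eval_term e (rho j)).
  rewrite (Hf2 n w) // ?eval_shift_term // Ee /v1.
  by rewrite (_ : eval_term _ (TVar _) = d1) // [LHS]/= tnthS.
have E3 d1 d2 : eval w1 A [tuple of d2 :: [tuple of d1 :: e]] f3 <->
    [|| eval_term e z != ord_max, d2 == ord_max | d1 == ord_max].
  rewrite (Hf3 n w) // D_or /= !eval_shift_term eqxx /=.
  rewrite (_ : tnth _ (lift _ _) = d1); last by rewrite tnthS.
  by split => [[]|]; [|exact|right].
split.
  case/existsP => d1 /existsP[d2 /and3P[/E3 H3 /E1 K1 /E2 K2]].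
  move: H3 K1 K2; case/or3P => [zm|/eqP ->|/eqP ->]; first by left.
    by rewrite eqxx; case=> // K _; right; left.
  by rewrite eqxx => _ [] // K; right; right.
have Om : (ord0 : 'I_n.+1) != ord_max by rewrite -val_eqE /= eq_sym -lt0n.
(* The inner witness guards [Q1] and the outer one guards [Q2]: a disjunct known to hold gets
   [ord_max], and [ord0] waives the other. *)
case=> [zm|[K|K]].
- apply/existsP; exists ord0; apply/existsP; exists ord0.
  by apply/and3P; split; [apply/E3; rewrite zm | apply/E1; left | apply/E2; left].
- apply/existsP; exists ord0; apply/existsP; exists ord_max.
  apply/and3P; split; [|by apply/E1; right|by apply/E2; left].
  by apply/E3; rewrite eqxx orbT.
- apply/existsP; exists ord_max; apply/existsP; exists ord0.
  apply/and3P; split; [|by apply/E1; left|by apply/E2; right].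
  by apply/E3; rewrite eqxx !orbT.
Qed.

Definition new_definable (o : update_type Sigma) (Q : query) : Prop :=
  cq_definable (fun n w i e => Q n (apply_update w o i) e).

(** The first [p] variables are skipped, and an index out of range becomes [$], in agreement with
    the default of [nth ord_max]. *)
Definition tuple_term p m j : term (p + m) :=
  if (insub j : option 'I_m) is Some k then TVar (rshift p k) else TEnd.

Lemma eval_tuple_term1 n m d (t : m.-tuple 'I_n.+1) :
  (fun j => eval_term [tuple of d :: t] (tuple_term 1 m j)) = nth ord_max t.
Proof.
apply: functional_extensionality => j; rewrite /tuple_term.
case: insubP => [k _ <-|]; last by rewrite -leqNgt => ?; rewrite nth_default ?size_tuple.
by rewrite /= (_ : rshift 1 k = lift ord0 k) ?tnthS ?(tnth_nth ord_max) //; apply: val_inj.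
Qed.

Theorem dyn_cq_of_definable (Qout : query) :
  (forall j, fo_definable (fun n e => desc_sem (D j) (empty_struct Sigma n) e)) ->
  fo_definable (fun n e => Qout n (empty_struct Sigma n) e) ->
  (forall o j, new_definable o (desc_sem (D j))) ->
  (forall o, new_definable o Qout) ->
  in_DynCQ (fun n w (t : m0.-tuple 'I_n.+1) => Qout n w (nth ord_max t)).
Proof.
move=> initD initO newD newO.
pose Q0 (r : option T) n (w : word_struct Sigma n) (e : nat -> 'I_n.+1) : Prop :=
  if r is Some j then e 0 != ord_max \/ desc_sem (D j) w (fun k => e k.+1)
  else Qout n w e.
have init_ex (r : aux_schema) : exists f : fo Sigma no_rel (arity r),
    forall n (t : (arity r).-tuple 'I_n.+1),
    eval (empty_struct Sigma n) (@no_db n) t f <->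
    Q0 r n (empty_struct Sigma n) (nth ord_max t).
  have H : fo_definable (fun n e => Q0 r n (empty_struct Sigma n) e).
    case: r => [j|] //=; apply: fo_or; last exact: (fo_ren succn (initD j)).
    apply: fo_iff (fo_not (fo_end 0)) => n e.
    by split => [/eqP|/eqP].
  have [f Hf] := H _ (fun j => @tuple_term 0 (arity r) j).
  exists f => n t; rewrite Hf; set e1 := (fun _ => _); set e2 := nth _ _.
  suff -> : e1 = e2 by [].
  apply: functional_extensionality => j; rewrite /e1 /e2 /tuple_term.
  case: insubP => [k _ <-|]; last by rewrite -leqNgt => ?; rewrite nth_default ?size_tuple.
  by rewrite /= (_ : rshift 0 k = k) ?(tnth_nth ord_max) //; apply: val_inj.
have upd_ex o (r : aux_schema) : exists f : fo Sigma aux_schema (arity r).+1,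
    is_cq f /\ forall n (w w1 : word_struct Sigma n) A i (t : (arity r).-tuple 'I_n.+1),
      0 < n -> w ord_max = None -> i != ord_max -> stores w A ->
      eval w1 A [tuple of i :: t] f <->
      Q0 r n (apply_update w o i) (nth ord_max t).
  case: r => [j|].
    set m := arity _.
    pose tt k : term m.+1 := tuple_term 1 m k.
    have [f cf Hf] := newD o j m.+1 (fun k => tt k.+1) (TVar ord0) (tt 0).
    exists f; split=> // n w w1 A i t n0 wm im st; rewrite (Hf n w) //.
    have E k : eval_term [tuple of i :: t] (tt k) = nth ord_max t k.
      by rewrite -(eval_tuple_term1 i t).
    rewrite E.
    by rewrite (_ : (fun k => eval_term _ (tt k.+1)) =
                    (fun k => nth ord_max t k.+1)) //;
      apply: functional_extensionality => k; rewrite E.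
  (* Guarding by the constant [$] leaves exactly the output query. *)
  have [f cf Hf] := newO o m0.+1 (fun k => tuple_term 1 m0 k) (TVar ord0) TEnd.
  exists f; split=> // n w w1 A i t n0 wm im st; rewrite (Hf n w) //.
  rewrite eval_tuple_term1 /= eqxx /=.
  by split => [[]|]; [|exact|right].
pose init r := proj1_sig (constructive_indefinite_description _ (init_ex r)).
pose upd o r := proj1_sig (constructive_indefinite_description _ (upd_ex o r)).
pose P := @DynProgram Sigma aux_schema init upd.
have initP r := proj2_sig (constructive_indefinite_description _ (init_ex r)).
have updP o r := proj2_sig (constructive_indefinite_description _ (upd_ex o r)).
exists P; first by move=> o r; case: (updP o r).
(* The invariant includes that [$] carries no letter: then a reset at [$] is illegal, so every
   updated position differs from [$] and the domain has a second element. *)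
have inv n (w : word_struct Sigma n) (A : aux_db (dp_schema P) n) :
    reachable w A -> w ord_max = None /\
    forall (r : aux_schema) (t : (arity r).-tuple 'I_n.+1),
      t \in A r <-> Q0 r n w (nth ord_max t).
  elim=> [|{}w {}A o i _ [wm HA] leg].
    split=> [|r t]; first by rewrite ffunE.
    by rewrite inE; apply: initP.
  have im : i != ord_max.
    case: o leg => [a /andP[]//|] /=; apply: contraNneq => ->.
    by rewrite wm.
  have n0 : 0 < n.
    by case: n i {w A wm HA leg} im => [|//] i; rewrite [i]ord1 -val_eqE.
  split=> [|r t]; first by rewrite ffunE eq_sym (negPf im).
  rewrite inE; case: (updP o r) => _ H.
  by apply: H => // j t'; apply: (HA (Some j)).
exists (None : aux_schema), erefl => n w A /inv[_ H] t.
by rewrite tcast_id; apply: H.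
Qed.

End Definability.

(** * Factors under updates *)

Section Factors.

Variables (Sigma : finType) (n : nat).
Implicit Types (w : word_struct Sigma n) (i x y z : 'I_n.+1).

(** The endpoints are natural numbers so that [y] may be [n.+1], one beyond the last position. *)
Definition factor w (x y : nat) : seq Sigma :=
  pmap (fun k => w (inord k)) (iota x (y - x)).

Lemma factor_geq w (x y : nat) : y <= x -> factor w x y = [::].
Proof. by rewrite /factor -subn_eq0 => /eqP ->. Qed.

Lemma factor_cat w (x z y : nat) : x <= z -> z <= y ->
  factor w x y = factor w x z ++ factor w z y.
Proof.
move=> xz zy; rewrite /factor (_ : y - x = (z - x) + (y - z)).
  by rewrite iotaD pmap_cat subnKC.
by rewrite addnC addnBA // subnK.
Qed.

Lemma pmap_eq_cat (S S' : Type) (f : S -> option S') s u v :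
  pmap f s = u ++ v ->
  exists2 k, k <= size s & pmap f (take k s) = u /\ pmap f (drop k s) = v.
Proof.
elim: s u => [|a s IH] u /=.
  by case: u => [|//] /= <-; exists 0.
case: u => [|b u].
  by move=> /= E; exists 0.
case fa: (f a) => [c|] /=.
  case=> <- /IH[k ks [E1 E2]]; exists k.+1 => //.
  by rewrite /= fa /= E1.
move=> /(IH (b :: u))[k ks [E1 E2]]; exists k.+1 => //.
by rewrite /= fa /= E1.
Qed.

(** A cut of a [pmap] comes from a cut of the underlying list; the cut position is at most [y],
    hence in the domain. Concatenation thus becomes an existential quantifier over positions. *)
Lemma factor_split w x y u v : x <= y -> factor w x y = u ++ v ->
  exists z, [/\ x <= z, z <= y, factor w x z = u & factor w z y = v].
Proof.
move=> xy /pmap_eq_cat[k]; rewrite size_iota => kyx [E1 E2].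
have zy : x + k <= y by rewrite -leq_subRL.
have zn : x + k < n.+1 by apply: leq_ltn_trans zy _.
exists (Ordinal zn); split=> //=; first exact: leq_addr.
  by rewrite -E1 /factor addKn take_iota (minn_idPl kyx).
by rewrite -E2 /factor drop_iota subnDA.
Qed.

Lemma pmap_eq_cons (S S' : Type) (f : S -> option S') s c v :
  pmap f s = c :: v ->
  exists s1 k s2, [/\ s = s1 ++ k :: s2, pmap f s1 = [::], f k = Some c & pmap f s2 = v].
Proof.
elim: s => //= a s IH; case fa: (f a) => [d|] /=.
  by case=> <- <-; exists [::], a, s.
by case/IH => s1 [k [s2 [-> E1 E2 E3]]]; exists (a :: s1), k, s2; rewrite /= fa.
Qed.

(** Positions without a letter may precede the first letter, hence the empty factor from [x] to
    [z]. *)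
Lemma factor_cons w x y c v : factor w x y = c :: v ->
  exists z z1 : 'I_n.+1, [/\ x <= z, z1 = z.+1 :> nat, z1 <= y &
    [/\ factor w x z = [::], w z = Some c & factor w z1 y = v]].
Proof.
move=> fE; have [s1 [k [s2 [E E1 E2 E3]]]] := pmap_eq_cons fE.
have sz : size s1 < y - x.
  by rewrite -(size_iota x (y - x)) E size_cat /= -addSnnS leq_addr.
have Ek : k = x + size s1.
  by rewrite -(nth_iota 0 x sz) E nth_cat ltnn subnn.
have ky : k < y by rewrite Ek -ltn_subRL.
have kn : k.+1 < n.+1 by apply: leq_ltn_trans ky _.
exists (Ordinal (ltnW kn)), (Ordinal kn); split=> //=; first by rewrite Ek leq_addr.
split.
- rewrite -E1 /factor Ek addKn.
  have -> : s1 = take (size s1) (iota x (y - x)) by rewrite E take_size_cat.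
  rewrite take_iota; congr (pmap _ (iota _ _)).
  by rewrite size_iota.
- by rewrite -E2; congr (w _); apply: val_inj; rewrite /= inordK // ltnW.
- rewrite -E3 /factor; congr pmap.
  have -> : s2 = drop (size s1).+1 (iota x (y - x)).
    by rewrite E -cat_rcons drop_size_cat // size_rcons.
  by rewrite drop_iota Ek addnS -subnDA addnS.
Qed.

Lemma factor1 w i (i1 : nat) : i1 = i.+1 ->
  factor w i i1 = if w i is Some a then [:: a] else [::].
Proof. by move=> ->; rewrite /factor subSnn /= inord_val; case: (w i). Qed.

Lemma factor_update_out w o i x y : i < x \/ y <= i ->
  factor (apply_update w o i) x y = factor w x y.
Proof.
move=> ixy; apply: eq_in_pmap => k; rewrite mem_iota => /andP[xk].
case: (leqP x y) => [xy|/ltnW]; last first.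
  by rewrite -subn_eq0 => /eqP ->; rewrite addn0 ltnNge xk.
rewrite subnKC // => ky.
rewrite ffunE ifN //; apply/eqP => ki.
have kn : k < n.+1 by apply: ltn_trans ky (ltn_ord y).
move: (congr1 (@nat_of_ord _) ki); rewrite inordK // => Ek.
rewrite Ek in xk ky.
by case: ixy => [|yi]; [rewrite ltnNge xk|rewrite ltnNge yi in ky].
Qed.

Definition new_letter (o : update_type Sigma) : seq Sigma :=
  if o is Ins a then [:: a] else [::].

Lemma factor_update_in w o i (i1 : 'I_n.+1) x y :
  i1 = i.+1 :> nat -> x <= i -> i1 <= y ->
  factor (apply_update w o i) x y = factor w x i ++ new_letter o ++ factor w i1 y.
Proof.
move=> Ei xi iy; have ii1 : i <= i1 by rewrite Ei.
rewrite (@factor_cat _ x i) ?(leq_trans ii1) // (@factor_cat _ i i1) //.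
rewrite (@factor_update_out _ _ _ x i); last by right.
rewrite (@factor_update_out _ _ _ i1 y) ?Ei; last by left.
by rewrite (factor1 _ (erefl i.+1)) ffunE eqxx; case: o.
Qed.

Definition occ (g : regex Sigma) w x y : Prop := x <= y /\ lang g (factor w x y).

Definition occ_eq w x y x' y' : Prop :=
  [/\ x <= y, x' <= y' & factor w x y = factor w x' y'].

Lemma lang_star_nil (g : regex Sigma) : lang (RStar g) [::].
Proof. by exists [::]. Qed.

Lemma lang_star_cat (g : regex Sigma) u v :
  lang (RStar g) u -> lang (RStar g) v -> lang (RStar g) (u ++ v).
Proof.
case=> us -> Hu [vs -> Hv]; exists (us ++ vs); first by rewrite flatten_cat.
by move=> s; rewrite mem_cat => /orP[/Hu|/Hv].
Qed.

Lemma lang_star1 (g : regex Sigma) u : lang g u -> lang (RStar g) u.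
Proof. by move=> gu; exists [:: u]; rewrite /= ?cats0 // => v /[!inE] /eqP ->. Qed.

(** [p ++ q] is the first block that ends strictly beyond [u]. It exists because [v] is nonempty,
    and this choice makes [q] nonempty. *)
Lemma lang_star_split (g : regex Sigma) u v : lang (RStar g) (u ++ v) -> v != [::] ->
  exists u1 p q v1, [/\ u = u1 ++ p, v = q ++ v1, q != [::],
    lang (RStar g) u1 & lang g (p ++ q) /\ lang (RStar g) v1].
Proof.
case=> ws; elim: ws u => [|c ws IH] u /=.
  by case: u v => [[]|].
move=> E Hg vN.
have gc : lang g c by apply: Hg; rewrite inE eqxx.
have Hg' s : s \in ws -> lang g s by move=> sw; apply: Hg; rewrite inE sw orbT.
case: (ltnP (size u) (size c)) => suc.
  have Ec : c = u ++ drop (size u) c.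
    rewrite -{1}(cat_take_drop (size u) c); congr (_ ++ _).
    by rewrite -(takel_cat (flatten ws) (ltnW suc)) -E take_size_cat.
  exists [::], u, (drop (size u) c), (flatten ws); split=> //.
  - by move: E; rewrite {1}Ec -catA => /eqP; rewrite eqseq_cat // eqxx => /eqP.
  - by rewrite -size_eq0 size_drop subn_eq0 -ltnNge.
  - exact: lang_star_nil.
  - by rewrite -Ec; split=> //; exists ws.
have Eu : u = c ++ drop (size c) u.
  rewrite -{1}(cat_take_drop (size c) u); congr (_ ++ _).
  by rewrite -(takel_cat v suc) E take_size_cat.
move: E; rewrite {1}Eu -catA => /eqP; rewrite eqseq_cat // eqxx => /eqP E.
have [u1 [p [q [v1 [E1 E2 qN H1 H2]]]]] := IH _ E Hg' vN.
exists (c ++ u1), p, q, v1; split=> //; first by rewrite -catA -E1.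
by apply: lang_star_cat => //; apply: lang_star1.
Qed.

Lemma lang_eps u : lang (RStar (@RVoid Sigma)) u <-> u = [::].
Proof.
split=> [[ws -> H]|->]; last exact: lang_star_nil.
by case: ws H => [//|v ws] /(_ v); rewrite inE eqxx => /(_ isT).
Qed.

(** The updated position and its successor are quantified as [I] and [I1], so that they become
    variables of a query. The last disjunct serves the case that the updated factor has no letter
    from [i] on, which requires a reset. *)
Lemma occ_star_update g w o i x y : i != ord_max ->
  occ (RStar g) (apply_update w o i) x y <->
  exists I I1 : 'I_n.+1, I = i /\ I1 = I.+1 :> nat /\
  ((I < x \/ y <= I) /\ occ (RStar g) w x y \/
   (exists z z', occ (RStar g) w x z /\ z <= I /\ I < z' /\
      occ g (apply_update w o i) z z' /\ occ (RStar g) w z' y) \/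
   new_letter o == [::] /\ occ (RStar g) w x I /\ occ (RStar g) w I1 y).
Proof.
move=> im; have in1 : i.+1 < n.+1.
  by rewrite ltnS ltn_neqAle -ltnS ltn_ord andbT; move: im; rewrite -val_eqE.
split; last first.
  case=> _ [I1 [-> [E1]]].
  case=> [[ixy [xy H]]|[|]].
  - by split=> //; rewrite factor_update_out.
  - case=> z [z' [[xz H1] [zi [iz' [[zz' H2] [z'y H3]]]]]].
    have xz' : x <= z' by apply: leq_trans zz'.
    split; first by apply: leq_trans z'y.
    rewrite (@factor_cat _ x z') // (@factor_cat _ x z) //.
    rewrite (@factor_update_out _ _ _ x z); last by right.
    rewrite (@factor_update_out _ _ _ z' y); last by left.
    by do 2?[apply: lang_star_cat => //]; apply: lang_star1.
  - case=> /eqP s0 [[xi H1] [iy H2]]; split; first by rewrite E1 in iy; apply: leq_trans (ltnW iy).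
    by rewrite (factor_update_in _ _ E1) // s0; apply: lang_star_cat.
case=> xy H; exists i, (Ordinal in1); do 2!split=> //.
case: (ltnP i x) => [ix|xi].
  by left; split; [left|split=> //; rewrite -(factor_update_out w o (or_introl ix))].
case: (leqP y i) => [yi|iy].
  by left; split; [right|split=> //; rewrite -(factor_update_out w o (or_intror yi))].
right; move: H; rewrite (factor_cat _ xi (ltnW iy)).
set w' := apply_update w o i.
(* If a letter remains from [i] on, the star is cut at [i]; the straddling block reaches strictly
   beyond the cut, which gives a right end [z'] greater than [i]. *)
have [v0|vN] := eqVneq (factor w' i y) [::]; last first.
  move=> /lang_star_split /(_ vN)[u1 [p [q [v1 [E1 E2 qN H1 [H2 H3]]]]]].
  have [z [xz zi Ez1 Ez2]] := factor_split xi E1.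
  have [z' [iz' zy' Ez1' Ez2']] := factor_split (ltnW iy) E2.
  have iz : i < z'.
    rewrite ltn_neqAle iz' andbT; apply: contraNneq qN => ii.
    by rewrite -Ez1' ii factor_geq.
  left; exists z, z'; do !split=> //.
  - by rewrite -(factor_update_out w o (or_intror zi)) Ez1.
  - exact: leq_trans iz'.
  - by rewrite (factor_cat _ zi iz') Ez1' Ez2.
  - by rewrite -(factor_update_out w o (or_introl iz)) Ez2'.
rewrite v0 cats0 (factor_update_out w o (or_intror (leqnn i))) => H.
right; move: v0; rewrite (@factor_update_in w o i (Ordinal in1)) //.
rewrite factor_geq //= => v0; split; first by case: (new_letter o) v0.
split=> //; split=> //; rewrite (_ : factor _ _ _ = [::]); last by case: (new_letter o) v0.
exact: lang_star_nil.
Qed.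

(** As a regular expression, the new letter can be searched for elsewhere in the word through [occ],
    uniformly for insertions and resets. *)
Definition new_letter_regex (o : update_type Sigma) : regex Sigma :=
  if o is Ins a then RChar a else REps.

Lemma lang_new_letter o u : lang (new_letter_regex o) u <-> u = new_letter o.
Proof. by case: o. Qed.

(* The disjuncts: [I] lies in neither factor, in the first only, or in both;
   in the last case the parts before [I] agree, or that of the first factor is
   the shorter one. *)
Definition eq_update_cond w o (i I I1 x y x' y' : 'I_n.+1) : Prop :=
  ((I < x \/ y <= I) /\ (I < x' \/ y' <= I) /\ occ_eq w x y x' y') \/
  (x <= I /\ I1 <= y /\ (I < x' \/ y' <= I) /\
     exists z z1, occ_eq w x I x' z /\
       occ (new_letter_regex o) (apply_update w o i) z z1 /\
       occ_eq w I1 y z1 y') \/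
  (occ_eq w x I x' I /\ occ_eq w I1 y I1 y') \/
  (exists z z1 t t1, occ_eq w x I x' z /\
     occ (new_letter_regex o) (apply_update w o i) z z1 /\
     occ_eq w z1 I I1 t /\
     occ (new_letter_regex o) (apply_update w o i) t t1 /\
     occ_eq w t1 y I1 y').

Lemma eq_update_cond_sound w o (i I1 x y x' y' : 'I_n.+1) :
  I1 = i.+1 :> nat -> eq_update_cond w o i i I1 x y x' y' ->
  occ_eq (apply_update w o i) x y x' y'.
Proof.
move=> E1; have iI : i <= I1 by rewrite E1.
have out_l (a b : 'I_n.+1) : b <= i ->
    factor (apply_update w o i) a b = factor w a b.
  by move=> bi; apply: factor_update_out; right.
have out_r (a b : 'I_n.+1) : I1 <= a ->
    factor (apply_update w o i) a b = factor w a b.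
  by move=> bi; apply: factor_update_out; left; rewrite -E1.
case=> [|[|[|]]].
- by case=> ixy [ixy' [xy xy' E]]; split; rewrite ?factor_update_out.
- case=> xi [iy [ixy' [z [z1 [[_ xz Ea] [[zz1 /lang_new_letter Es] [_ zy Eb]]]]]]].
  have xz1 := leq_trans xz zz1.
  split; first exact: leq_trans (leq_trans iI _).
    exact: leq_trans zy.
  rewrite (factor_update_in _ _ E1) // (factor_cat _ xz1 zy) (factor_cat _ xz zz1).
  rewrite Es Ea Eb -catA.
  rewrite (@factor_update_out _ _ _ x' z); last first.
    by case: ixy' => [|yi]; [left|right; apply: leq_trans (leq_trans zz1 zy) _].
  rewrite (@factor_update_out _ _ _ z1 y') //.
  by case: ixy' => [ix|]; [left; apply: leq_trans xz1|right].
- case=> [[xi xi' Ea] [iy iy' Eb]]; split.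
  + exact: leq_trans (leq_trans iI _).
  + exact: leq_trans (leq_trans iI _).
  + by rewrite !(factor_update_in _ _ E1) // Ea Eb.
- case=> z [z1 [t [t1 [[xi xz Ea] [[zz1 /lang_new_letter Es] [[zi it Eb]
    [[tt1 /lang_new_letter Et] [ty iy Ec]]]]]]]].
  have xi' := leq_trans (leq_trans xz zz1) zi.
  have iy1 := leq_trans (leq_trans it tt1) ty.
  split.
  + exact: leq_trans (leq_trans iI _).
  + exact: leq_trans (leq_trans iI _).
  (* With [a] the new letter, both sides become w[x, i) a w[z1, i) a w[t1, y): the first factor is
     cut behind [i] at [t] and [t1], the second before [i] at [z] and [z1]. *)
  rewrite !(factor_update_in _ _ E1) //.
  rewrite (factor_cat _ (leq_trans it tt1) ty) (factor_cat _ it tt1).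
  rewrite (factor_cat _ (leq_trans xz zz1) zi) (factor_cat _ xz zz1).
  rewrite Ea -Eb Ec -!catA -(out_l z z1) // -(out_r t t1) //.
  by rewrite Es Et.
Qed.

Lemma cat_eq_prefix (S : eqType) (u v u' v' : seq S) :
  u ++ v = u' ++ v' -> size u <= size u' -> exists r, u' = u ++ r /\ v = r ++ v'.
Proof.
move=> E su; exists (drop (size u) u').
have Eu : u' = u ++ drop (size u) u'.
  rewrite -{1}(cat_take_drop (size u) u'); congr (_ ++ _).
  by rewrite -(takel_cat v' su) -E take_size_cat.
split=> //; move: E; rewrite {1}Eu -catA => /eqP.
by rewrite eqseq_cat // eqxx => /eqP.
Qed.

(** The condition is not symmetric in the two factors. The swapped alternative covers [i] lying in
    the second factor only, and the part before [i] being shorter in the second factor. *)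
Lemma eq_update_cond_complete w o (i I1 x y x' y' : 'I_n.+1) :
  I1 = i.+1 :> nat -> occ_eq (apply_update w o i) x y x' y' ->
  eq_update_cond w o i i I1 x y x' y' \/ eq_update_cond w o i i I1 x' y' x y.
Proof.
move=> E1; have iI : i <= I1 by rewrite E1.
have out (a b : 'I_n.+1) (r : i < a \/ b <= i) := factor_update_out w o r.
have one_sided (a b a' b' : 'I_n.+1) : a <= b -> a' <= b' -> a <= i -> I1 <= b ->
    i < a' \/ b' <= i ->
    factor (apply_update w o i) a b = factor (apply_update w o i) a' b' ->
    eq_update_cond w o i i I1 a b a' b'.
  move=> ab ab' ai ib iab'; rewrite (factor_update_in _ _ E1) // => /esym E.
  have [z [a'z zb' Ez1 Ez2]] := factor_split ab' E.
  have [z1 [zz1 zb1 Ez3 Ez4]] := factor_split zb' Ez2.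
  right; left; do 3!split=> //; exists z, z1; split.
    split=> //; rewrite -Ez1 out //.
    by case: iab' => [|bi]; [left|right; apply: leq_trans bi].
  split; first by split=> //; apply/lang_new_letter.
  split=> //; rewrite -Ez4 out //.
  by case: iab' => [ia|]; [left; apply: leq_trans (leq_trans a'z zz1)|right].
have two_sided (a b a' b' : 'I_n.+1) : a <= i -> I1 <= b -> a' <= i -> I1 <= b' ->
    size (factor w a i) <= size (factor w a' i) ->
    factor (apply_update w o i) a b = factor (apply_update w o i) a' b' ->
    eq_update_cond w o i i I1 a b a' b'.
  move=> ai ib ai' ib' sz; rewrite !(factor_update_in _ _ E1) // => E.
  right; right; case: (ltngtP (size (factor w a i)) (size (factor w a' i))) sz => // sz _; last first.
    left; move/eqP: E; rewrite eqseq_cat // => /andP[/eqP Ea].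
    by rewrite eqseq_cat // eqxx /= => /eqP Eb.
  (* The new letter has length at most one, so w[a, i) followed by it is still a prefix of the
     strictly longer w[a', i). The rest [r] is w[z1, i) and also w[I1, t). *)
  right; move: E; rewrite catA => E.
  have [|r [Er Ev]] := cat_eq_prefix E.
    rewrite size_cat; apply: leq_trans sz.
    by rewrite -[leqRHS]addn1 leq_add2l; case: (o).
  rewrite -catA in Er.
  have [z [az zi Ez1 Ez2]] := factor_split ai' Er.
  have [z1 [zz1 zi1 Ez3 Ez4]] := factor_split zi Ez2.
  have [t [it tb Et1 Et2]] := factor_split ib Ev.
  have [t1 [tt1 tb1 Et3 Et4]] := factor_split tb Et2.
  exists z, z1, t, t1; do !split=> //.
  - by apply/lang_new_letter; rewrite out //; right.
  - by rewrite Ez4 Et1.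
  - by apply/lang_new_letter; rewrite out //; left; rewrite -E1.
case=> xy xy' E.
have pos (a b : 'I_n.+1) : (i < a \/ b <= i) \/ (a <= i /\ I1 <= b).
  case: (ltnP i a) => [|ai]; first by left; left.
  by case: (leqP b i) => [|ib]; [left; right|right; rewrite E1].
case: (pos x y) (pos x' y') => [ixy|[xi iy]] [ixy'|[xi' iy']].
- by left; left; do 3!split=> //; rewrite -!out.
- by right; apply: one_sided.
- by left; apply: one_sided.
- case: (leqP (size (factor w x i)) (size (factor w x' i))) => [|/ltnW] sz.
    by left; apply: two_sided.
  by right; apply: two_sided.
Qed.

Lemma occ_eq_update w o i x y x' y' : i != ord_max ->
  occ_eq (apply_update w o i) x y x' y' <->
  exists I I1 : 'I_n.+1, I = i /\ I1 = I.+1 :> nat /\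
  (eq_update_cond w o i I I1 x y x' y' \/ eq_update_cond w o i I I1 x' y' x y).
Proof.
move=> im; have in1 : i.+1 < n.+1.
  by rewrite ltnS ltn_neqAle -ltnS ltn_ord andbT; move: im; rewrite -val_eqE.
split=> [H|[_ [I1 [-> [E1 []]]]]].
- exists i, (Ordinal in1); do 2!split=> //.
  exact: eq_update_cond_complete H.
- exact: eq_update_cond_sound.
- by move/(eq_update_cond_sound E1) => [? ? E].
Qed.

End Factors.

(** * Maintaining regular constraints and equality of factors *)

Section Maintenance.

Variable Sigma : finType.

Fixpoint star_bodies (g : regex Sigma) : seq (regex Sigma) :=
  match g with
  | RAlt g1 g2 | RCat g1 g2 => star_bodies g1 ++ star_bodies g2
  | RStar g1 => g1 :: star_bodies g1
  | _ => [::]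
  end.

Lemma star_bodies_trans g h k :
  List.In h (star_bodies g) -> List.In k (star_bodies h) ->
  List.In k (star_bodies g).
Proof.
elim: g => //= [g1 IH1 g2 IH2|g1 IH1 g2 IH2|g1 IH1].
- by move=> /List.in_app_iff[H|H] K; apply/List.in_app_iff; [left|right]; auto.
- by move=> /List.in_app_iff[H|H] K; apply/List.in_app_iff; [left|right]; auto.
- by case=> [->|H] K; right; auto.
Qed.

Definition le_desc : desc Sigma := Desc 2 (fun n w e => e 0 <= e 1).
Definition succ_desc : desc Sigma := Desc 2 (fun n w e => e 1 = (e 0).+1 :> nat).
Definition first_desc : desc Sigma := Desc 1 (fun n w e => e 0 = ord0).
Definition last_desc : desc Sigma := Desc 1 (fun n w e => e 0 = ord_max).
Definition eq_desc : desc Sigma :=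
  Desc 4 (fun n w e => occ_eq w (e 0) (e 1) (e 2) (e 3)).

Variables (N : nat) (gs : 'I_N -> regex Sigma) (m0 : nat).

(** Order and letter predicates are stored as well, since the built-in atoms have no guard argument.
    The summands index six fixed relations, the letters, and one star for each [gs j]. *)
Definition kind : finType := ('I_6 + Sigma + 'I_N)%type.

Definition stored_desc (k : kind) : desc Sigma :=
  match k with
  | inl (inl j) => nth (or_desc Sigma)
      [:: or_desc Sigma; le_desc; succ_desc; first_desc; last_desc; eq_desc] j
  | inl (inr a) => Desc 1 (fun n w e => w (e 0) = Some a)
  | inr j => Desc 2 (fun n w e => occ (RStar (gs j)) w (e 0) (e 1))
  end.

(* [RVoid] is included because emptiness of a factor is stored as membership in
   the star of the empty language. *)
Definition covered (g : regex Sigma) : Prop :=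
  forall h, List.In h (RVoid :: star_bodies g) -> exists j, gs j = h.

Lemma covered_sub g h :
  (forall k, List.In k (star_bodies h) -> List.In k (star_bodies g)) ->
  covered g -> covered h.
Proof. by move=> S C k [H|/S H]; apply: C; [left|right]. Qed.

Definition kind_static j (H : j < 6) : kind := inl (inl (Ordinal H)).

Notation cqdef := (cq_definable stored_desc m0).
Notation newdef := (new_definable stored_desc m0).

Lemma cq_or Q1 Q2 : cqdef Q1 -> cqdef Q2 ->
  cqdef (fun n w i e => Q1 n w i e \/ Q2 n w i e).
Proof. exact: (@cq_or_of_stored _ _ _ m0 (kind_static (isT : 0 < 6)) erefl). Qed.

Lemma cq_le a b : cqdef (fun n w i e => e a <= e b).
Proof. exact: (@cq_rel _ _ stored_desc m0 (kind_static (isT : 1 < 6)) [:: a; b] erefl). Qed.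

Lemma cq_succ a b : cqdef (fun n w i e => e b = (e a).+1 :> nat).
Proof. exact: (@cq_rel _ _ stored_desc m0 (kind_static (isT : 2 < 6)) [:: a; b] erefl). Qed.

Lemma cq_first a : cqdef (fun n w i e => e a = ord0).
Proof. exact: (@cq_rel _ _ stored_desc m0 (kind_static (isT : 3 < 6)) [:: a] erefl). Qed.

Lemma cq_last a : cqdef (fun n w i e => e a = ord_max).
Proof. exact: (@cq_rel _ _ stored_desc m0 (kind_static (isT : 4 < 6)) [:: a] erefl). Qed.

Lemma cq_occ_eq a b c d : cqdef (fun n w i e => occ_eq w (e a) (e b) (e c) (e d)).
Proof.
exact: (@cq_rel _ _ stored_desc m0 (kind_static (isT : 5 < 6)) [:: a; b; c; d] erefl).
Qed.

Lemma cq_letter c a : cqdef (fun n w i e => w (e a) = Some c).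
Proof. exact: (@cq_rel _ _ stored_desc m0 (inl (inr c)) [:: a] erefl). Qed.

Lemma cq_star j a b : cqdef (fun n w i e => occ (RStar (gs j)) w (e a) (e b)).
Proof. exact: (@cq_rel _ _ stored_desc m0 (inr j) [:: a; b] erefl). Qed.

Lemma cq_lt a b : cqdef (fun n w i e => e a < e b).
Proof.
apply: (@cq_iff _ _ _ _ (fun n w i e =>
    exists s : 'I_n.+1, s = (e a).+1 :> nat /\ s <= e b)).
  move=> n w i e _ _ _; split=> [[s [->]]//|ab].
  by exists (Ordinal (leq_ltn_trans ab (ltn_ord (e b)))).
apply: cq_ex; apply: cq_and; [exact: cq_succ|exact: cq_le].
Qed.

Lemma cq_eq a b : cqdef (fun n w i e => e a = e b).
Proof.
apply: (@cq_iff _ _ _ _ (fun n w i e => e a <= e b /\ e b <= e a)).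
  move=> n w i e _ _ _; split=> [[ab ba]|->//].
  by apply/val_inj/eqP; rewrite eqn_leq ab.
by apply: cq_and; apply: cq_le.
Qed.

Lemma cq_at_pos a : cqdef (fun n w i e => e a = i).
Proof.
exact: (@cq_pos _ _ _ _ (fun n w i I e => e a = I) (cq_eq a.+1 0)).
Qed.

Lemma cq_bool (b : bool) : cqdef (fun n w i e => b).
Proof.
case: b; first exact: (@cq_iff _ _ _ _ (fun _ _ _ _ => True) _ _ (cq_true _ _)).
(* Falsity needs a guarded form too: no position is its own successor. *)
apply: (@cq_iff _ _ _ _ (fun n w i e => exists s : 'I_n.+1, s = s.+1 :> nat)).
  by move=> n w i e _ _ _; split=> [[s]|//] => /eqP; rewrite ltn_eqF.
by apply: cq_ex; apply: cq_succ.
Qed.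

(** Without negation, being different from the updated position is written as being smaller or
    larger. At that position the answer depends only on [o] and [c]. *)
Lemma new_letter_definable o c a : newdef o (fun n w e => w (e a) = Some c).
Proof.
pose b := if o is Ins a then a == c else false.
apply: (@cq_iff _ _ _ _ (fun n w i e => (exists I : 'I_n.+1, I = i /\
    (e a = I /\ b \/ (e a < I \/ I < e a) /\ w (e a) = Some c)))).
  move=> n w i e _ _ _; rewrite ffunE; split.
    case=> _ [-> [[-> ]|[]]].
      by rewrite eqxx /b; case: (o) => // d /eqP ->.
    by move=> ai <-; rewrite ifN //; apply/eqP => ea; case: ai; rewrite ea ltnn.
  move=> H; exists i; split=> //; move: H; case: eqP => [ea|/eqP ea] H.
    by left; split=> //; move: H; rewrite /b; case: (o) => // d [->].
  right; split=> //; apply/orP; move: ea; rewrite -val_eqE.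
  by rewrite neq_ltn.
apply: cq_ex; apply: cq_and; first exact: cq_at_pos.
apply: cq_or; apply: cq_and; first exact: cq_eq.
- exact: cq_bool.
- by apply: cq_or; apply: cq_lt.
- exact: cq_letter.
Qed.

(** In [occ_star_update] the star is matched in the old word only, but its body in the updated one;
    hence the hypothesis on [gs j]. *)
Lemma new_star_definable o j a b :
  (forall a b, newdef o (fun n w e => occ (gs j) w (e a) (e b))) ->
  newdef o (fun n w e => occ (RStar (gs j)) w (e a) (e b)).
Proof.
move=> H; have H' c d : cqdef (fun n w i e => occ (gs j) (apply_update w o i) (e c) (e d)).
  exact: H.
apply: cq_iff => [n w i e _ _ im|]; first by symmetry; apply: occ_star_update.
do 2!apply: cq_ex; apply: cq_and; first exact: cq_at_pos.
apply: cq_and; first exact: cq_succ.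
apply: cq_or.
  apply: cq_and; last exact: cq_star.
  by apply: cq_or; [exact: cq_lt|exact: cq_le].
apply: cq_or.
  do 2!apply: cq_ex; apply: cq_and; first exact: cq_star.
  apply: cq_and; first exact: cq_le.
  apply: cq_and; first exact: cq_lt.
  by apply: cq_and; [exact: H'|exact: cq_star].
apply: cq_and; first exact: cq_bool.
by apply: cq_and; exact: cq_star.
Qed.

Lemma new_occ_definable o g a b : covered g ->
  newdef o (fun n w e => occ g w (e a) (e b)).
Proof.
move=> cg; have [jv Ejv] := cg RVoid (or_introl erefl).
have void c d : newdef o (fun n w e => occ (@RVoid Sigma) w (e c) (e d)).
  apply: (@cq_iff _ _ _ _ (fun _ _ _ _ => false)); last exact: cq_bool.
  by move=> n w i e _ _ _; split=> // [[]].
(* [REps] has the same language as the star of [RVoid], whose matches are stored. *)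
have eps c d : newdef o (fun n w e => occ (@REps Sigma) w (e c) (e d)).
  apply: (@cq_iff _ _ _ _ (fun n w i e =>
      occ (RStar RVoid) (apply_update w o i) (e c) (e d))).
    by move=> n w i e _ _ _; split=> [[? /lang_eps]|[? /lang_eps]].
  by rewrite -Ejv; apply: new_star_definable => c' d'; rewrite Ejv; apply: void.
elim: g a b cg => [||c|g1 IH1 g2 IH2|g1 IH1 g2 IH2|g IH] {}a {}b cg.
- exact: void.
- exact: eps.
- apply: (@cq_iff _ _ _ _ (fun n w i e => exists z z1 : 'I_n.+1,
      occ REps (apply_update w o i) (e a) z /\ apply_update w o i z = Some c /\
      z1 = z.+1 :> nat /\ occ REps (apply_update w o i) z1 (e b))).
    move=> n w i e _ wm im; set w' := apply_update w o i; split.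
      case=> z [z1 [[az E1] [wz [Ez [zb E2]]]]].
      have zz1 : z <= z1 by rewrite Ez.
      split; first exact: leq_trans (leq_trans zz1 _).
      rewrite /= in E1 E2; rewrite /= (factor_cat _ az (leq_trans zz1 zb)).
      by rewrite (factor_cat _ zz1 zb) E1 E2 (factor1 _ Ez) wz.
    case=> ab /factor_cons[z [z1 [az Ez zb [E1 wz E2]]]].
    by exists z, z1; do !split.
  do 2!apply: cq_ex; apply: cq_and; first exact: (eps a.+2 1).
  apply: cq_and; first exact: (new_letter_definable o c 1).
  by apply: cq_and; [exact: cq_succ|exact: (eps 0 b.+2)].
- have c1 : covered g1 by apply: covered_sub cg => h H; apply/List.in_app_iff; left.
  have c2 : covered g2 by apply: covered_sub cg => h H; apply/List.in_app_iff; right.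
  apply: cq_iff (cq_or (IH1 a b c1) (IH2 a b c2)) => n w i e _ _ _ /=; rewrite /occ /=.
  by split=> [[[? ?]|[? ?]]|[? [?|?]]]; [split=> //; left|split=> //; right|left|right].
- have c1 : covered g1 by apply: covered_sub cg => h H; apply/List.in_app_iff; left.
  have c2 : covered g2 by apply: covered_sub cg => h H; apply/List.in_app_iff; right.
  apply: (@cq_iff _ _ _ _ (fun n w i e => exists z,
      occ g1 (apply_update w o i) (e a) z /\ occ g2 (apply_update w o i) z (e b))).
    move=> n w i e _ _ _; split.
      case=> z [[az H1] [zb H2]]; split; first exact: leq_trans zb.
      by rewrite (factor_cat _ az zb); do 2!eexists; split; first reflexivity.
    case=> ab [u1 [u2 [E H1 H2]]].
    have [z [az zb E1 E2]] := factor_split ab E.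
    by exists z; split; split; rewrite ?E1 ?E2.
  by apply: cq_ex; apply: cq_and; [exact: (IH1 a.+1 0)|exact: (IH2 0 b.+1)].
- have cg1 : covered g by apply: covered_sub cg => h H; right.
  have [j Ej] : exists j, gs j = g by apply: cg; right; left.
  by rewrite -Ej; apply: new_star_definable => c d; rewrite Ej; apply: IH.
Qed.

Lemma cq_eq_update_cond o g I I1 a b c d : covered g ->
  cqdef (fun n w i e => eq_update_cond w o i (e I) (e I1) (e a) (e b) (e c) (e d)).
Proof.
move=> cg; have cg' : covered (new_letter_regex o).
  by apply: covered_sub cg => h; case: o.
have letter p q : cqdef (fun n w i e =>
    occ (new_letter_regex o) (apply_update w o i) (e p) (e q)).
  exact: (new_occ_definable o p q cg').
have out p q : cqdef (fun n w i e => e I < e p \/ e q <= e I).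
  by apply: cq_or; [exact: cq_lt|exact: cq_le].
apply: cq_or.
  do 2!(apply: cq_and; first exact: out); exact: cq_occ_eq.
apply: cq_or.
  do 2!(apply: cq_and; first exact: cq_le).
  apply: cq_and; first exact: out.
  do 2!apply: cq_ex; apply: cq_and; first exact: cq_occ_eq.
  by apply: cq_and; [exact: letter|exact: cq_occ_eq].
apply: cq_or; first by apply: cq_and; exact: cq_occ_eq.
do 4!apply: cq_ex; do 2!(apply: cq_and; first exact: cq_occ_eq; apply: cq_and; first exact: letter).
exact: cq_occ_eq.
Qed.

Lemma new_occ_eq_definable o g a b c d : covered g ->
  newdef o (fun n w e => occ_eq w (e a) (e b) (e c) (e d)).
Proof.
move=> cg; apply: cq_iff => [n w i e _ _ im|]; first by symmetry; apply: occ_eq_update.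
do 2!apply: cq_ex; apply: cq_and; first exact: cq_at_pos.
apply: cq_and; first exact: cq_succ.
apply: cq_or; [exact: (cq_eq_update_cond o 1 0 a.+2 b.+2 c.+2 d.+2 cg)|].
exact: (cq_eq_update_cond o 1 0 c.+2 d.+2 a.+2 b.+2 cg).
Qed.

Lemma stored_update_definable o g k : covered g -> (forall j, covered (gs j)) ->
  newdef o (desc_sem (stored_desc k)).
Proof.
move=> cg cgs; case: k => [[[j]|c]|j].
- case: j => [|[|[|[|[|[|//]]]]]] lj.
  + exact: (@cq_rel _ _ stored_desc m0 (kind_static (isT : 0 < 6)) [:: 0; 1; 2] erefl).
  + exact: cq_le.
  + exact: cq_succ.
  + exact: cq_first.
  + exact: cq_last.
  + exact: (new_occ_eq_definable o 0 1 2 3 cg).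
- exact: (new_letter_definable o c 0).
- by apply: new_star_definable => a b; apply: new_occ_definable.
Qed.

Lemma factor_empty n x y : factor (empty_struct Sigma n) x y = [::].
Proof. by rewrite /factor; elim: (iota _ _) => //= k s ->; rewrite ffunE. Qed.

(** All factors of the empty structure are the empty word, so equality and star matches only
    constrain the order of the endpoints. *)
Lemma stored_init_definable k :
  fo_definable Sigma
    (fun n e => desc_sem (stored_desc k) (empty_struct Sigma n) e).
Proof.
have le a b : fo_definable Sigma (fun n e => e a <= e b).
  apply: fo_iff (fo_not (fo_lt Sigma b a)) => n e.
  by rewrite [e a <= _]leqNgt; split=> /negP.
case: k => [[[j]|c]|j].
- case: j => [|[|[|[|[|[|//]]]]]] lj.
  + have last := fo_end Sigma.
    apply: fo_iff (fo_or (fo_not (last 0)) (fo_or (last 1) (last 2))) => n e /=.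
    split=> [[/eqP ->//|[->|->]]|/or3P[/eqP|/eqP|/eqP]]; rewrite ?eqxx ?orbT //; tauto.
  + exact: le.
  + apply: (@fo_iff _ (fun n e =>
        e 0 < e 1 /\ ~ exists z : 'I_n.+1, e 0 < z /\ z < e 1)); last first.
      apply: fo_and; first exact: fo_lt.
      by apply: fo_not; apply: fo_ex; apply: fo_and; apply: fo_lt.
    move=> n e /=.
    split=> [[lt H]|->]; last first.
      by split=> // -[d [H1]]; rewrite ltnS leqNgt H1.
    apply/eqP; rewrite eqn_leq lt andbT leqNgt; apply/negP => lt'; apply: H.
    by exists (Ordinal (leq_trans lt' (ltnW (ltn_ord (e 1))))); split=> //=.
  + apply: (@fo_iff _ (fun n e => ~ exists z : 'I_n.+1, z < e 0)); last first.
      by apply: fo_not; apply: fo_ex; apply: fo_lt.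
    move=> n e /=.
    split=> [H|-> [d]//]; apply/val_inj/eqP => /=; rewrite -leqn0 leqNgt.
    by apply/negP => e0; apply: H; exists ord0.
  + exact: fo_end.
  + apply: fo_iff (fo_and (le 0 1) (le 2 3)) => n e /=.
    by rewrite /occ_eq !factor_empty; split=> [[]|[]].
- apply: fo_iff (fo_const Sigma False) => n e /=; by rewrite ffunE.
- apply: fo_iff (le 0 1) => n e /=; rewrite /occ factor_empty.
  by split=> [|[]//]; split=> //; apply: lang_star_nil.
Qed.

Lemma new_iff o (Q1 Q2 : query Sigma) :
  (forall n (w : word_struct Sigma n) e, w ord_max = None -> Q1 n w e <-> Q2 n w e) ->
  newdef o Q1 -> newdef o Q2.
Proof.
move=> E; apply: cq_iff => n w i e _ wm im; apply: E.
by rewrite ffunE eq_sym (negPf im).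
Qed.

Lemma new_and o Q1 Q2 : newdef o Q1 -> newdef o Q2 ->
  newdef o (fun n w e => Q1 n w e /\ Q2 n w e).
Proof. exact: cq_and. Qed.

Lemma new_or o Q1 Q2 : newdef o Q1 -> newdef o Q2 ->
  newdef o (fun n w e => Q1 n w e \/ Q2 n w e).
Proof. exact: cq_or. Qed.

Lemma new_ex o (Q : forall n, word_struct Sigma n ->
                  (nat -> 'I_n.+1) -> 'I_n.+1 -> Prop) :
  newdef o (fun n w e => Q n w (fun j => e j.+1) (e 0)) ->
  newdef o (fun n w e => exists d, Q n w e d).
Proof. exact: cq_ex. Qed.

Lemma new_ren o (f : nat -> nat) Q :
  newdef o Q -> newdef o (fun n w e => Q n w (fun j => e (f j))).
Proof. exact: (@cq_ren _ _ _ _ f). Qed.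

Lemma new_le o a b : newdef o (fun n w e => e a <= e b).
Proof. exact: cq_le. Qed.

Lemma new_lt o a b : newdef o (fun n w e => e a < e b).
Proof. exact: cq_lt. Qed.

Lemma new_true o : newdef o (fun n w e => True).
Proof. exact: cq_true. Qed.

(** * Word terms and formulas *)

Definition word_term := forall n, word_struct Sigma n -> (nat -> 'I_n.+1) -> seq Sigma.

(** Queries have positions, not words, as arguments; a word is accessed through the intervals that
    spell it. Their endpoints are variables 0 and 1, so those of [u] are shifted by two. *)
Definition representable o (u : word_term) : Prop :=
  newdef o (fun n w e =>
    e 0 <= e 1 /\ factor w (e 0) (e 1) = u n w (fun j => e j.+2)).

Lemma representable_at o u (f : nat -> nat) a b : representable o u ->
  newdef o (fun n w e =>
    e a <= e b /\ factor w (e a) (e b) = u n w (fun j => e (f j))).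
Proof.
exact: (@new_ren o (fun j => match j with 0 => a | 1 => b | j'.+2 => f j' end)).
Qed.

Lemma representable_ren o u (f : nat -> nat) : representable o u ->
  representable o (fun n w e => u n w (fun j => e (f j))).
Proof. exact: (@representable_at o u (fun j => (f j).+2)). Qed.

Lemma representable_nil o g : covered g -> representable o (fun n w e => [::]).
Proof.
move=> cg; have cE : covered REps by apply: covered_sub cg.
exact: (new_occ_definable o 0 1 cE).
Qed.

Lemma representable_letter o g c :
  covered g -> representable o (fun n w e => [:: c]).
Proof.
move=> cg; have cE : covered (RChar c) by apply: covered_sub cg.
exact: (new_occ_definable o 0 1 cE).
Qed.

Lemma representable_cat o u v : representable o u -> representable o v ->
  representable o (fun n w e => u n w e ++ v n w e).
Proof.
move=> Hu Hv.
apply: (@new_iff _ (fun n w e => exists z : 'I_n.+1,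
    (e 0 <= z /\ factor w (e 0) z = u n w (fun j => e j.+2)) /\
    (z <= e 1 /\ factor w z (e 1) = v n w (fun j => e j.+2)))).
  move=> n w e _; split.
    case=> z [[az <-] [zb <-]]; split; first exact: leq_trans zb.
    exact: factor_cat.
  by case=> ab /(factor_split ab)[z [az zb E1 E2]]; exists z; do !split.
apply: new_ex; apply: new_and.
  exact: (@representable_at o u (fun j => j.+3) 1 0 Hu).
exact: (@representable_at o v (fun j => j.+3) 0 2 Hv).
Qed.

(** [occ_eq] requires ordered endpoints, whereas [factor] is empty on reversed ones; this case is a
    disjunct of its own. *)
Lemma representable_factor o g a b :
  covered g -> representable o (fun n w e => factor w (e a) (e b)).
Proof.
move=> cg; apply: (@new_iff _ (fun n w e =>
    occ_eq w (e 0) (e 1) (e a.+2) (e b.+2) \/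
    e b.+2 < e a.+2 /\ (e 0 <= e 1 /\ factor w (e 0) (e 1) = [::]))).
  move=> n w e _; split.
    case=> [[le01 _ E]|[ba [le01 E]]]; split=> //.
    by rewrite (factor_geq _ (ltnW ba)).
  case=> le01 E; case: (leqP (e a.+2) (e b.+2)) => ab; [by left|right].
  by do !split=> //; rewrite E factor_geq // ltnW.
apply: new_or; first exact: new_occ_eq_definable cg.
by apply: new_and; [exact: new_lt|exact: representable_nil cg].
Qed.

Lemma pmap_ord n (w : word_struct Sigma n) (s : seq 'I_n.+1) :
  pmap w s = pmap (fun k => w (inord k)) [seq val z | z <- s].
Proof. by elim: s => //= z s ->; rewrite inord_val. Qed.

Lemma word_between_factor n (w : word_struct Sigma n) (x y : 'I_n.+1) :
  word_between w x y = factor w x y.+1.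
Proof.
rewrite /word_between pmap_ord /factor; congr pmap.
rewrite -(filter_map val (fun k => x <= k <= y)) val_enum_ord.
(* Both lists of positions are strictly increasing, so having the same members suffices. *)
apply: (irr_sorted_eq ltn_trans ltnn).
- by apply: (sorted_filter ltn_trans); apply: iota_ltn_sorted.
- exact: iota_ltn_sorted.
move=> k; rewrite mem_filter !mem_iota /= add0n.
case: (leqP x y.+1) => xy.
  rewrite subnKC // [k < y.+1]ltnS; case: (leqP k y) => ky; rewrite ?andbF //.
  by rewrite (leq_ltn_trans ky (ltn_ord y)) ?andbT.
have -> : y.+1 - x = 0 by apply/eqP; rewrite subn_eq0 ltnW.
rewrite addn0.
case: (leqP x k) => xk //=; rewrite leqNgt (leq_trans _ xk) //.
by rewrite ltnW.
Qed.

Lemma word_of_factor n (w : word_struct Sigma n) : word_of w = factor w 0 n.+1.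
Proof. by rewrite /word_of pmap_ord val_enum_ord. Qed.

(** The endpoint [n.+1] is not a position, but [n] is the position [$], which carries no letter and
    can serve instead. *)
Lemma factor_last n (w : word_struct Sigma n) (x : 'I_n.+1) :
  w ord_max = None -> factor w x n.+1 = factor w x n.
Proof.
move=> wm; rewrite (factor_cat w (leq_ord x) (leqnSn n)).
by rewrite (factor1 _ (i := ord_max) erefl) wm cats0.
Qed.

Lemma representable_word_between o g a b :
  covered g -> representable o (fun n w e => word_between w (e a) (e b)).
Proof.
(* The right endpoint of the half-open interval is the successor of [e b]; if [e b] is [$], which
   has none, [$] itself is used. *)
move=> cg; apply: (@new_iff _ (fun n w e =>
   (exists s : 'I_n.+1, s = (e b.+2).+1 :> nat /\
     (e 0 <= e 1 /\ factor w (e 0) (e 1) = factor w (e a.+2) s)) \/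
   e b.+2 = ord_max /\
   (e 0 <= e 1 /\ factor w (e 0) (e 1) = factor w (e a.+2) (e b.+2)))).
  move=> n w e wm; rewrite word_between_factor; split.
    case=> [[s [<- H]]//|[Eb [le01 ->]]]; split=> //.
    by rewrite Eb factor_last.
  case=> le01 E; case: (eqVneq (e b.+2) ord_max) => Eb.
    by right; rewrite E Eb factor_last.
  have bn : (e b.+2).+1 < n.+1.
    by rewrite ltnS ltn_neqAle -ltnS ltn_ord andbT.
  by left; exists (Ordinal bn).
apply: new_or.
  apply: new_ex; apply: new_and; first exact: cq_succ.
  exact: (representable_at (fun j => match j with 0 => a.+3 | _ => 0 end) 1 2
            (representable_factor o 0 1 cg)).
apply: new_and; first exact: cq_last.
exact: (representable_factor o a b cg).
Qed.

Lemma representable_word_of o g : covered g -> representable o (fun n w e => word_of w).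
Proof.
move=> cg; apply: (@new_iff _ (fun n w e => exists x y : 'I_n.+1, x = ord0 /\ y = ord_max /\
   (e 0 <= e 1 /\ factor w (e 0) (e 1) = factor w x y))).
  move=> n w e wm; rewrite word_of_factor (factor_last ord0) //; split.
    by case=> _ [_ [-> [->]]].
  by move=> H; exists ord0, ord_max.
do 2!apply: new_ex; apply: new_and; first exact: cq_first.
apply: new_and; first exact: cq_last.
exact: (representable_at (fun j => match j with 0 => 1 | _ => 0 end) 2 3
            (representable_factor o 0 1 cg)).
Qed.

(** This supplies the witness when a condition on the value of [u] is turned into the existence of
    an interval that spells it. *)
Definition factor_term (u : word_term) : Prop :=
  forall n (w : word_struct Sigma n) e, w ord_max = None ->
    exists x y : 'I_n.+1, x <= y /\ factor w x y = u n w e.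

Lemma representable_subst o g (u : var -> word_term) alpha :
  covered g -> (forall v, representable o (u v)) ->
  representable o (fun n w e => subst (fun v => u v n w e) alpha).
Proof.
move=> cg Hu; elim: alpha => [|[c|v] alpha IH]; first exact: representable_nil cg.
  exact: (representable_cat (representable_letter o c cg) IH).
exact: (representable_cat (Hu v) IH).
Qed.

Fixpoint epfc_star_bodies (phi : epfc Sigma) : seq (regex Sigma) :=
  match phi with
  | EEq _ _ => [::]
  | EReg _ g => star_bodies g
  | EAnd p q | EOr p q => epfc_star_bodies p ++ epfc_star_bodies q
  | EEx _ p => epfc_star_bodies p
  end.

(** Atoms are checked on an interval spelling the value of [x]. A quantified variable becomes an
    interval inside one spelling the universe, which is why the induction is over arbitrary word
    terms [u]. *)
Lemma models_definable o phi (u : var -> word_term) :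
  (forall h, List.In h (RVoid :: epfc_star_bodies phi) -> exists j, gs j = h) ->
  (forall v, representable o (u v)) -> (forall v, factor_term (u v)) ->
  newdef o (fun n w e => models (fun v => u v n w e) phi).
Proof.
move=> cphi; have cg : covered RVoid by move=> h [H|//]; apply: cphi; left.
elim: phi u cphi => [x alpha|x g|p IHp q IHq|p IHp q IHq|x p IH] u cphi Hu Fu.
- apply: (@new_iff _ (fun n w e => exists a b : 'I_n.+1,
      (a <= b /\ factor w a b = u x n w e) /\
      (a <= b /\ factor w a b = subst (fun v => u v n w e) alpha))).
    move=> n w e wm /=; split; first by case=> a [b [[_ <-] [_ <-]]].
    have [a [b [ab E]]] := Fu x n w e wm.
    by move=> E'; exists a, b; rewrite -E' E.
  do 2!apply: new_ex; apply: new_and.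
    exact: (representable_at (fun j => j.+2) 1 0 (Hu x)).
  exact: (representable_at (fun j => j.+2) 1 0 (representable_subst alpha cg Hu)).
- apply: (@new_iff _ (fun n w e => exists a b : 'I_n.+1,
      (a <= b /\ factor w a b = u x n w e) /\ occ g w a b)).
    move=> n w e wm /=; split; first by case=> a [b [[_ <-] [_ ]]].
    have [a [b [ab E]]] := Fu x n w e wm.
    by move=> H; exists a, b; rewrite /occ E.
  do 2!apply: new_ex; apply: new_and.
    exact: (representable_at (fun j => j.+2) 1 0 (Hu x)).
  exact: (new_occ_definable o 1 0 cphi).
- apply: new_and; [apply: IHp|apply: IHq] => // h [H|H]; apply: cphi; try by left.
    by right; apply/List.in_app_iff; left.
  by right; apply/List.in_app_iff; right.
- apply: new_or; [apply: IHp|apply: IHq] => // h [H|H]; apply: cphi; try by left.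
    by right; apply/List.in_app_iff; left.
  by right; apply/List.in_app_iff; right.
- apply: (@new_iff _ (fun n w e => exists a b c d : 'I_n.+1,
      (a <= b /\ factor w a b = u uvar n w e) /\ (a <= c /\ c <= d /\ d <= b) /\
      models (update_subst (fun v => u v n w e) x (factor w c d)) p)).
    move=> n w e wm /=; split.
      case=> a [b [c [d [[ab <-] [[ac [cd db]] H]]]]]; exists (factor w c d) => //.
      apply/infixP; exists (factor w a c), (factor w d b).
      by rewrite -!factor_cat // (leq_trans cd).
    case=> v /infixP[s1 [s2 E]] H; have [a [b [ab E1]]] := Fu uvar n w e wm.
    rewrite E in E1.
    have [c [ac cb E2 E3]] := factor_split ab E1.
    have [d [cd db E4 E5]] := factor_split cb E3.
    by exists a, b, c, d; rewrite E E4; do !split=> //; rewrite E1.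
  do 4!apply: new_ex; apply: new_and.
    exact: (representable_at (fun j => j.+4) 3 2 (Hu uvar)).
  apply: new_and.
    by do 2?apply: new_and; exact: new_le.
  (* Below the four quantifiers [c] and [d] are variables 1 and 0, and the environment of [u] starts
     at variable 4. *)
  pose u' v : word_term := fun n w e =>
    if v == Some x then factor w (e 1) (e 0) else u v n w (fun j => e j.+4).
  apply: (IH u') => // v; rewrite /u'; case: (v == Some x).
  + exact: representable_factor cg.
  + exact: (representable_ren (fun j => j.+4) (Hu v)).
  + move=> n w e wm; case: (leqP (e 1) (e 0)) => le10; first by exists (e 1), (e 0).
    by exists ord0, ord0; rewrite !factor_geq // ltnW.
  + by move=> n w e wm; apply: Fu.
Qed.

End Maintenance.

(** * Free variables and starred subexpressions of formulas *)

Lemma update_subst_eq (Sigma : Type) (s s' : var -> seq Sigma) x v y :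
  (y != Some x -> s y = s' y) -> update_subst s x v y = update_subst s' x v y.
Proof. by rewrite /update_subst; case: eqP => // _ /(_ isT). Qed.

(** Agreement on the universe variable is asked for even if it is not free, since quantifiers range
    over the factors of its value. *)
Lemma models_ext (Sigma : eqType) (phi : epfc Sigma) s s' :
  s uvar = s' uvar -> (forall v, v \in free_vars phi -> s v = s' v) ->
  models s phi -> models s' phi.
Proof.
elim: phi s s' => [x alpha|x g|p IHp q IHq|p IHp q IHq|x p IH] s s' Eu E /=.
- rewrite -(E x) ?inE ?eqxx // => ->.
  have {E} : forall v, v \in pmap (fun t => if t is inr y then Some y else None) alpha ->
      s v = s' v by move=> v av; apply: E; rewrite inE av orbT.
  elim: alpha => [//|[c|y] alpha IH] E; rewrite /subst /= -!/(subst _ _).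
    by rewrite IH.
  by rewrite IH ?E ?inE ?eqxx // => v av; apply: E; rewrite inE av orbT.
- by rewrite E ?inE.
- case=> Hp Hq; split.
    by apply: IHp Hp => // v pv; apply: E; rewrite mem_cat pv.
  by apply: IHq Hq => // v qv; apply: E; rewrite mem_cat qv orbT.
- case=> [Hp|Hq]; [left|right].
    by apply: IHp Hp => // v pv; apply: E; rewrite mem_cat pv.
  by apply: IHq Hq => // v qv; apply: E; rewrite mem_cat qv orbT.
- case=> v; rewrite Eu => vu Hp; exists v => //; apply: IH Hp => [|y py].
    exact: update_subst_eq.
  by apply: update_subst_eq => yx; apply: E; rewrite mem_filter yx.
Qed.

Lemma exists_index_of_In (S : Type) (s : seq S) (x0 x : S) :
  List.In x s -> exists j : 'I_(size s), nth x0 s j = x.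
Proof.
elim: s => //= y s IH [<-|/IH[j <-]]; first by exists ord0.
by exists (lift ord0 j).
Qed.

Lemma epfc_star_bodies_trans (Sigma : finType) (phi : epfc Sigma) h k :
  List.In h (epfc_star_bodies phi) -> List.In k (star_bodies h) ->
  List.In k (epfc_star_bodies phi).
Proof.
elim: phi => //= [x g|p IHp q IHq|p IHp q IHq]; first exact: star_bodies_trans.
all: by move=> /List.in_app_iff[H|H] K; apply/List.in_app_iff; [left|right]; auto.
Qed.

(** Without negation, carrying a letter is expressed as a disjunction over the finite alphabet. *)
Lemma letter_at_definable (Sigma : finType) N (gs : 'I_N -> regex Sigma) m0 o a :
  new_definable (stored_desc gs) m0 o (fun n w e => w (e a) != None).
Proof.
apply: (@new_iff _ _ _ _ _ (fun n w e =>
    exists2 c, c \in enum Sigma & w (e a) = Some c)).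
  move=> n w e _; split=> [[c _ ->]//|].
  by case: (w (e a)) => [c|//] _; exists c; rewrite ?mem_enum.
elim: (enum Sigma) => [|c s IH].
  apply: (@cq_iff _ _ _ _ (fun _ _ _ _ => false)); last exact: cq_bool.
  by move=> n w i e _ _ _; split=> // [[]].
apply: new_iff (new_or (new_letter_definable gs m0 o c a) IH) => n w e _.
split=> [[E|[d ds E]]|[d]].
- by exists c; rewrite ?inE ?eqxx.
- by exists d; rewrite // inE ds orbT.
- by rewrite inE => /predU1P[->|ds] E; [left|right; exists d].
Qed.

(** * The relation to be maintained, as a query *)

Section Output.

Variables (Sigma : finType) (k : nat) (xs : k.-tuple nat) (phi : epfc Sigma).

(** The pairing of indices is that of [bar]. A variable outside [xs] gets the empty word, a factor
    of every input. *)
Definition var_term (v : var) : word_term Sigma := fun n w e =>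
  if v is Some x then
    if x \in xs then
      word_between w (e (2 * index x xs)) (e (2 * index x xs).+1)
    else [::]
  else word_of w.

Definition output : query Sigma := fun n w e =>
  (forall j, j < 2 * k -> w (e j) != None) /\
  models (fun v => var_term v w e) phi.

Lemma infix_word_between n (w : word_struct Sigma n) x y :
  infix (word_between w x y) (word_of w).
Proof.
rewrite word_between_factor word_of_factor.
case: (leqP x y.+1) => xy; last first.
  by rewrite (factor_geq w (ltnW xy)) infix0s.
apply/infixP; exists (factor w 0 x), (factor w y.+1 n.+1).
have yn : y.+1 <= n.+1 by apply: ltn_ord.
by rewrite -(factor_cat w xy yn) -(factor_cat w (leq0n x) (leq_trans xy yn)).
Qed.

Lemma infix_var_term v n (w : word_struct Sigma n) e :
  infix (var_term v w e) (word_of w).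
Proof.
case: v => [x|] /=; last exact: infix_refl.
by case: ifP => _; [exact: infix_word_between|exact: infix0s].
Qed.

Lemma factor_term_var_term v : factor_term (var_term v).
Proof.
move=> n w e wm; have /infixP[s1 [s2]] := infix_var_term v w e.
rewrite word_of_factor (factor_last ord0 wm) => E.
have [x [_ xn _ E2]] := @factor_split _ _ w ord0 ord_max _ _ (leq0n _) E.
have [y [xy _ E3 _]] := factor_split xn E2.
by exists x, y.
Qed.

Lemma output_definable N (gs : 'I_N -> regex Sigma) m0 o :
  (forall h, List.In h (RVoid :: epfc_star_bodies phi) -> exists j, gs j = h) ->
  new_definable (stored_desc gs) m0 o output.
Proof.
move=> cphi; have cg : covered gs RVoid by move=> h [H|//]; apply: cphi; left.
apply: new_and.
  elim: (2 * k) => [|j IH].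
    by apply: new_iff (new_true gs m0 o) => n w e _; split.
  apply: new_iff (new_and IH (letter_at_definable gs m0 o j)) => n w e _.
  split=> [[H1 H2] l|H]; last by split=> [l lj|]; apply: H => //; apply: ltnW.
  by rewrite ltnS leq_eqVlt => /predU1P[->|/H1].
apply: (@models_definable _ _ gs m0 o phi var_term) => // v.
  case: v => [x|]; last exact: representable_word_of cg.
  rewrite /var_term; case: (x \in xs); last exact: representable_nil cg.
  exact: representable_word_between cg.
exact: factor_term_var_term.
Qed.

(** On the empty structure the letter condition fails unless k = 0. In that case the output is the
    truth of [phi] with all variables empty, a proposition independent of [n]. *)
Lemma output_init_definable :
  fo_definable Sigma (fun n e => output (empty_struct Sigma n) e).
Proof.
have := fo_const Sigma (2 * k = 0 /\ models (fun=> [::]) phi).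
apply: fo_iff => n e; rewrite /output.
have -> : (fun v => var_term v (empty_struct Sigma n) e) = (fun=> [::]).
  apply: functional_extensionality => -[x|] /=.
    by rewrite word_between_factor factor_empty if_same.
  by rewrite word_of_factor factor_empty.
split=> -[H M]; split=> //; first by rewrite H.
by case: (2 * k) H => // j /(_ 0 isT); rewrite ffunE.
Qed.

(** A substitution witnessing [defined_rel] agrees with [var_term] on the universe and on the free
    variables; conversely [var_term] is such a substitution, as its values are factors of the
    input. *)
Lemma bar_output (R : word_rel Sigma k) :
  uniq xs -> (forall x, (x \in xs) = (Some x \in free_vars phi)) ->
  (forall w t, R w t <-> defined_rel phi xs w t) ->
  forall n (w : word_struct Sigma n) (t : (2 * k).-tuple 'I_n.+1),
    bar R w t <-> output w (nth ord_max t).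
Proof.
move=> Uxs Exs ER n w t; rewrite /bar /output ER.
have lettersE : (forall z, z \in t -> w z != None) <->
    (forall j, j < 2 * k -> w (nth ord_max t j) != None).
  split=> [H j jk|H z /(nthP ord_max)[j]]; first by apply: H; rewrite mem_nth ?size_tuple.
  by rewrite size_tuple => jk <-; apply: H.
rewrite lettersE; suff -> : defined_rel phi xs (word_of w)
     [tuple word_between w (nth ord_max t (2 * i)) (nth ord_max t (2 * i).+1) | i < k]
     <-> models (fun v => var_term v w (nth ord_max t)) phi by [].
split.
  case=> s [s0 _ H E]; apply: models_ext H => // -[x|] // xphi.
  have xxs : x \in xs by rewrite Exs.
  have ik : index x xs < k by rewrite -[X in _ < X](size_tuple xs) index_mem.
  rewrite /var_term xxs.
  have := congr1 (fun u => tnth u (Ordinal ik)) E.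
  by rewrite tnth_mktuple tnth_map (tnth_nth 0) /= nth_index.
move=> H; exists (fun v => var_term v w (nth ord_max t)); split=> //.
  by move=> v; apply: infix_var_term.
apply: eq_from_tnth => i; rewrite tnth_mktuple tnth_map /var_term mem_tnth.
by rewrite (tnth_nth 0) index_uniq ?size_tuple.
Qed.

End Output.

Theorem mainTheorem17 (Sigma : finType) (k : nat) (R : word_rel Sigma k) :
  epfc_definable R -> maintained_in_DynCQ R.
Proof.
case=> phi [xs [Uxs Exs ER]].
(* This list is closed under taking star bodies of its members, as the update of a stored star
   refers to the stars inside its body. *)
pose hs := RVoid :: epfc_star_bodies phi.
pose gs (j : 'I_(size hs)) := nth RVoid hs j.
have gs_In h : List.In h hs -> exists j, gs j = h by apply: exists_index_of_In.
have void : covered gs RVoid by move=> h [H|//]; apply: gs_In; left.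
have In_gs j : List.In (gs j) hs.
  rewrite /gs; elim: (hs) j => [[]//|g s IH] j.
  case: (unliftP ord0 j) => [j' ->|->]; [right; exact: IH|by left].
have gs_covered j : covered gs (gs j).
  move=> h [H|H]; apply: gs_In; first by left.
  by case: (In_gs j) => [E|/epfc_star_bodies_trans/(_ H)]; [rewrite -E in H|right].
have [P cqP [r [e H]]] := @dyn_cq_of_definable _ _ (stored_desc gs) (2 * k)
  (output xs phi) (stored_init_definable gs) (output_init_definable xs phi)
  (fun o j => stored_update_definable (2 * k) o j void gs_covered)
  (fun o => output_definable xs (2 * k) o gs_In).
exists P => //; exists r, e => n w A rA t.
by rewrite (H n w A rA t); split=> /(bar_output Uxs Exs ER).
Qed.
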